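(* $N$ is abelian and has finite dimension if and only if the spectral scale $B$ has a finite number of extreme points.
   Context: $M$ is a finite von Neumann algebra with a faithful normal tracial state $\tau$, $n$ is a positive integer, and $b_1,\dots,b_n\in M$ are self-adjoint; $N$ is the von Neumann subalgebra of $M$ generated by $b_1,\dots,b_n$ and $1$. $M_1^+=\{a\in M:0\le a\le 1\}$, $\Psi(a)=(\tau(a),\tau(b_1a),\dots,\tau(b_na))$, and $B=\Psi(M_1^+)\subset\mathbb R^{n+1}$ is the spectral scale of the $b_i$'s relative to $\tau$, a compact convex set. *)

(* Defs.v *)
From HB Require Import structures.
From mathcomp Require Import all_boot all_order all_algebra.
From mathcomp Require Import complex.
From mathcomp Require Import all_classical all_reals all_analysis.
Set Implicit Arguments.
Unset Strict Implicit.
Unset Printing Implicit Defensive.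
Import Order.TTheory GRing.Theory Num.Theory.
Import numFieldNormedType.Exports.
Local Open Scope classical_set_scope.
Local Open Scope ring_scope.

Section Operators.
(* [dot] is only assumed here to be an inner product on the Banach space [H];
   [hilbert_dot] says that it induces the norm of [H]. *)
Variables (R : realType) (H : completeNormedModType R[i]).
Variable dot : {dot H for @Num.conj R[i]}.

Definition hilbert_dot := forall x : H, `|x| ^+ 2 = dot x x.

(* B(H), as a set of plain functions. *)
Definition bounded_operator : set (H -> H) :=
  [set f | linear f /\ continuous f].

Definition is_adjoint (f g : H -> H) := forall x y, dot (f x) y = dot x (g y).

Definition self_adjoint (f : H -> H) := is_adjoint f f.

(* [0 <= z] in [R[i]] means that z is real and nonnegative. *)
Definition positive_operator (f : H -> H) := forall x, 0 <= dot (f x) x.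

Definition op_le (f g : H -> H) := positive_operator (g - f).

Definition commutant (S : set (H -> H)) : set (H -> H) :=
  [set f | bounded_operator f /\ forall g, S g -> f \o g = g \o f].

(* A *-closed set of operators equal to its bicommutant; being a unital
   subalgebra of B(H) is a consequence. *)
Definition von_neumann_algebra (M : set (H -> H)) :=
  (forall f, M f -> exists2 g, M g & is_adjoint f g) /\
  commutant (commutant M) = M.

(* The identity is a finite projection of M. *)
Definition finite_algebra (M : set (H -> H)) :=
  forall v w, M v -> M w -> is_adjoint v w -> w \o v = id -> v \o w = id.

Definition generated_von_neumann (M S : set (H -> H)) : set (H -> H) :=
  smallest [set A | von_neumann_algebra A /\ A `<=` M] (S `|` [set id]).

Definition abelian_algebra (M : set (H -> H)) :=
  forall f g, M f -> M g -> f \o g = g \o f.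

Definition finite_dimensional (M : set (H -> H)) :=
  exists (k : nat) (e : 'I_k -> H -> H), (forall i, M (e i)) /\
    forall f, M f -> exists c : 'I_k -> R[i], f = \sum_(i < k) c i *: e i.

Definition is_lub_in (M D : set (H -> H)) (f : H -> H) :=
  [/\ M f, forall d, D d -> op_le d f &
      forall g, M g -> (forall d, D d -> op_le d g) -> op_le f g].

Definition directed (D : set (H -> H)) := D !=set0 /\
  forall f g, D f -> D g -> exists h, [/\ D h, op_le f h & op_le g h].

(* A functional on M is a function on all of [H -> H], about which nothing is
   assumed outside M. *)
Definition normal_functional (M : set (H -> H)) (tau : (H -> H) -> R[i]) :=
  forall D f, D `<=` M `&` positive_operator -> directed D -> is_lub_in M D f ->
  forall r, (forall d, D d -> tau d <= r) -> tau f <= r.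

Definition state (M : set (H -> H)) (tau : (H -> H) -> R[i]) :=
  [/\ forall c f g, M f -> M g -> tau (c *: f + g) = c * tau f + tau g,
      forall f, M f -> positive_operator f -> 0 <= tau f &
      tau id = 1].

Definition tracial (M : set (H -> H)) (tau : (H -> H) -> R[i]) :=
  forall f g, M f -> M g -> tau (f \o g) = tau (g \o f).

Definition faithful (M : set (H -> H)) (tau : (H -> H) -> R[i]) :=
  forall f, M f -> positive_operator f -> tau f = 0 -> f = 0.

Definition faithful_normal_tracial_state (M : set (H -> H))
    (tau : (H -> H) -> R[i]) :=
  [/\ state M tau, tracial M tau, faithful M tau & normal_functional M tau].

Definition positive_unit_ball (M : set (H -> H)) : set (H -> H) :=
  [set a | [/\ M a, positive_operator a & op_le a id]].

(* For b_i self-adjoint and a positive, tau (b_i a) = tau (a^(1/2) b_i a^(1/2))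
   is real, so that taking real parts loses nothing. *)
Definition spectral_map (tau : (H -> H) -> R[i]) (n : nat)
    (b : 'I_n -> H -> H) (a : H -> H) : 'rV[R]_(1 + n) :=
  row_mx (\row_(_ < 1) complex.Re (tau a))
         (\row_(i < n) complex.Re (tau (b i \o a))).

Definition spectral_scale (M : set (H -> H)) (tau : (H -> H) -> R[i]) (n : nat)
    (b : 'I_n -> H -> H) : set 'rV[R]_(1 + n) :=
  spectral_map tau b @` positive_unit_ball M.

End Operators.

Definition extreme_points (R : realType) (V : lmodType R) (A : set V) : set V :=
  [set x | A x /\ forall y z t, A y -> A z -> 0 < t < 1 ->
     x = t *: y + (1 - t) *: z -> y = z].

(* Main.v *)
Require Import Defs.
From HB Require Import structures.
From mathcomp Require Import all_boot all_order all_algebra.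
From mathcomp Require Import complex.
From mathcomp Require Import all_classical all_reals all_analysis.
From mathcomp Require Import ring lra.
Set Implicit Arguments.
Unset Strict Implicit.
Unset Printing Implicit Defensive.
Import Order.TTheory GRing.Theory Num.Theory.
Import numFieldNormedType.Exports.
Local Open Scope classical_set_scope.
Local Open Scope ring_scope.

(** Call resolution a finite family of pairwise orthogonal projections [q i] of sum
    [1]. Both sides of the equivalence amount to the existence of a joint
    resolution of the [b j] in [N]: one with [b j * q i] a real multiple of [q i]
    for all [i] and [j].

    Given a joint resolution, the spectral scale is a zonotope: the numbers
    [tau (q i * a)] fill a box when [a] runs over the positive contractions, and
    the image of [a] is a linear function of them ([spectral_scale_zonotope]). A
    zonotope has finitely many extreme points. Moreover the span of the [q i] is a
    von Neumann algebra ([von_neumann_resolution_span]), so it contains [N], which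
    is therefore abelian and of finite dimension.

    If [N] is abelian and of finite dimension, a largest family of nonzero
    orthogonal projections of [N] is a resolution, and each [q i] lies under any
    projection of [N] or under its complement. Applied to the spectral projections
    of [b j - s] for all real [s], this forces [b j] to be a scalar on the range of
    [q i] ([scalar_of_decided]).

    If the spectral scale has finitely many extreme points, the key is that every
    spectral projection [p] of a real combination [c] of the [b j] and [1], for the
    open half-line of positive reals, is mapped to an extreme point, and is the
    only positive contraction of [M] with that image ([spec_proj_extreme]): [p]
    has the least trace among the maximizers of [tau (c * a)]. There are thus
    finitely many such projections in all. Two distinct operators [b i + e b j]
    share their spectral projections, which makes [b i] and [b j] commute
    ([finite_pencil_proj_comm]); then the atoms of the spectral projections of the
    [b j] form a joint resolution.

    Spectral projections are built by hand, inside the bicommutant of the operator: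
    absolute values come from an iteration for the square root of a positive
    operator ([exists_sqrt]), projections onto kernels from the powers of a
    positive contraction ([exists_kernel_projection]), both as strong limits. *)

(** * Bounded operators form an algebra *)

Section BoundedOperators.
Variables (R : realType) (H : completeNormedModType R[i]).
Local Notation C := R[i].

Definition is_bop : {pred H -> H} := fun f => `[< bounded_operator f >].

Lemma is_bopP (f : H -> H) : reflect (bounded_operator f) (f \in is_bop).
Proof. exact: asboolP. Qed.

Lemma is_bop_submod : submod_closed is_bop.
Proof.
split.
  apply/is_bopP; split; first by move=> k x y; rewrite /= scaler0 addr0.
  exact: cst_continuous.
move=> k f g /is_bopP[lf cf] /is_bopP[lg cg]; apply/is_bopP; split.
  move=> l x y; rewrite !fctE lf lg !scalerDr !scalerA (mulrC k l) -!addrA.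
  by congr (_ + _); rewrite addrCA.
move=> x; apply: cvgD; last exact: cg.
by apply: cvgZr; exact: cf.
Qed.

HB.instance Definition _ := GRing.isSubmodClosed.Build C (H -> H) is_bop
  is_bop_submod.

(** The operators form a ring that is trivial when [H] is: hence a [pzRingType],
    with the compatibility of scaling and composition stated separately. *)
Record bop := Bop { bop_fun :> H -> H; bopP : bop_fun \in is_bop }.

HB.instance Definition _ := [isSub for bop_fun].
HB.instance Definition _ := [Choice of bop by <:].
HB.instance Definition _ := [SubChoice_isSubLmodule of bop by <:].

Lemma bop_linear (f : bop) : linear f.
Proof. by have /is_bopP[] := bopP f. Qed.

Lemma bop_continuous (f : bop) : continuous f.
Proof. by have /is_bopP[] := bopP f. Qed.

HB.instance Definition _ (f : bop) :=
  GRing.isLinear.Build C H H *:%R f (bop_linear f).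

Fact id_bop : id \in is_bop.
Proof. by apply/is_bopP; split=> // x; exact: cvg_id. Qed.

Fact comp_bop (f g : bop) : f \o g \in is_bop.
Proof.
apply/is_bopP; split; first by move=> k x y; rewrite /= !linearP.
move=> x; apply: continuous_comp; exact: bop_continuous.
Qed.

Definition bop1 := Bop id_bop.
Definition bop_mul f g := Bop (comp_bop f g).

Lemma bop_eqP (f g : bop) : f =1 g -> f = g.
Proof. by move=> fg; apply/val_inj/funext. Qed.

Fact bop_mulA : associative bop_mul.
Proof. by move=> f g h; apply: bop_eqP. Qed.
Fact bop_mul1r : left_id bop1 bop_mul.
Proof. by move=> f; apply: bop_eqP. Qed.
Fact bop_mulr1 : right_id bop1 bop_mul.
Proof. by move=> f; apply: bop_eqP. Qed.
Fact bop_mulDl : left_distributive bop_mul +%R.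
Proof. by move=> f g h; apply: bop_eqP. Qed.
Fact bop_mulDr : right_distributive bop_mul +%R.
Proof. by move=> f g h; apply: bop_eqP => x; rewrite /= linearD. Qed.

HB.instance Definition _ := GRing.Zmodule_isPzRing.Build bop
  bop_mulA bop_mul1r bop_mulr1 bop_mulDl bop_mulDr.

Lemma bop_scaleAl (k : C) (f g : bop) : k *: (f * g) = (k *: f) * g.
Proof. by apply: bop_eqP. Qed.
Lemma bop_scaleAr (k : C) (f g : bop) : k *: (f * g) = f * (k *: g).
Proof. by apply: bop_eqP => x /=; rewrite linearZ. Qed.

Lemma bop1E x : (1 : bop) x = x. Proof. by []. Qed.
Lemma bop0E x : (0 : bop) x = 0. Proof. by []. Qed.
Lemma bopME (f g : bop) x : (f * g) x = f (g x). Proof. by []. Qed.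
Lemma bopDE (f g : bop) x : (f + g) x = f x + g x. Proof. by []. Qed.
Lemma bopNE (f : bop) x : (- f) x = - f x. Proof. by []. Qed.
Lemma bopZE k (f : bop) x : (k *: f) x = k *: f x. Proof. by []. Qed.
Definition bopE := (bop1E, bop0E, bopME, bopDE, bopNE, bopZE).

Lemma bop_D (f : bop) x y : f (x + y) = f x + f y.
Proof. exact: linearD. Qed.
Lemma bop_N (f : bop) x : f (- x) = - f x.
Proof. exact: linearN. Qed.
Lemma bop_Z (f : bop) k x : f (k *: x) = k *: f x.
Proof. exact: linearZ. Qed.
Lemma bop_0 (f : bop) : f 0 = 0.
Proof. exact: linear0. Qed.
Definition bop_lin := (bop_D, bop_N, bop_Z, bop_0).

End BoundedOperators.

(** * The inner product *)

Section Dot.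
Variables (R : realType) (H : completeNormedModType R[i]).
Variable dot : {dot H for @Num.conj R[i]}.
Local Notation C := R[i].
Local Notation bop := (bop H).
Implicit Types (x y z : H) (k : C) (f g h c d p q : bop).

Lemma dotDl x y z : dot (x + y) z = dot x z + dot y z.
Proof. by rewrite linearDl. Qed.
Lemma dotDr x y z : dot z (x + y) = dot z x + dot z y.
Proof. by rewrite linearD. Qed.
Lemma dotNl x z : dot (- x) z = - dot x z.
Proof. by rewrite linearNl. Qed.
Lemma dotNr x z : dot z (- x) = - dot z x.
Proof. by rewrite linearN. Qed.
Lemma dotZl k x z : dot (k *: x) z = k * dot x z.
Proof. by rewrite linearZl_LR. Qed.
Lemma dotZr k x z : dot z (k *: x) = k^* * dot z x.
Proof. by rewrite linearZr_LR. Qed.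
Lemma dot0l z : dot 0 z = 0.
Proof. by rewrite linear0l. Qed.
Lemma dot0r z : dot z 0 = 0.
Proof. by rewrite linear0. Qed.
Lemma dotC x y : dot x y = (dot y x)^*.
Proof. by rewrite hermC /= expr0 mul1r. Qed.
Definition dotE := (dotDl, dotDr, dotNl, dotNr, dotZl, dotZr).

Lemma dot_ge0 x : 0 <= dot x x. Proof. exact: dnorm_ge0. Qed.
Lemma dot_eq0 x : dot x x = 0 -> x = 0.
Proof. by move/eqP; rewrite dnorm_eq0 => /eqP. Qed.

End Dot.

(** * Positive operators *)

Section Positive.
Variables (R : realType) (H : completeNormedModType R[i]).
Variable dot : {dot H for @Num.conj R[i]}.
Local Notation C := R[i].
Local Notation bop := (bop H).
Local Notation sa f := (self_adjoint dot (bop_fun f)).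
Local Notation pos f := (positive_operator dot (bop_fun f)).
Implicit Types (x y z : H) (k : C) (f g h c d p q : bop).

Lemma dot_ext x y : (forall z, dot x z = dot y z) -> x = y.
Proof.
move=> xy; apply/eqP; rewrite -subr_eq0; apply/eqP/(@dot_eq0 _ _ dot).
by rewrite dotDl dotNl xy subrr.
Qed.

(** Polarization: the quadratic form of a positive operator takes real values
    at [x + y] and at [x + 'i *: y]. *)
Lemma pos_sa f : pos f -> sa f.
Proof.
move=> f0 x y.
have re z : (dot (f z) z)^* = dot (f z) z by rewrite geC0_conj ?f0.
have := re (x + 'i *: y); have := re (x + y).
rewrite !bop_lin !dotE !(rmorphD, rmorphM) /= !re conjCK conjCi.
rewrite (dotC dot x (f y)); set u := dot (f x) y; set v := dot (f y) x.
set X := dot (f x) x; set Y := dot (f y) y => /eqP; rewrite -subr_eq0 => /eqP E1.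
move=> /eqP; rewrite -subr_eq0 => /eqP E2; have i2 := sqrCi C.
apply: (@mulfI _ 2); first by rewrite pnatr_eq0.
apply/eqP; rewrite -subr_eq0; apply/eqP; set i := 'i in i2 E2.
(* [u + v] and ['i * (v - u)] are real. *)
rewrite [LHS](_ : _ = - (X + u^* + (v^* + Y) - (X + u + (v + Y)))
  - i * (X + i * u^* + (- i * v^* + - i * (i * Y)) -
         (X + - i * u + (i * v + i * (- i * Y)))) +
  (i ^+ 2 + 1) * (u - v - v^* + u^*));
  last by ring.
by rewrite E1 E2 i2 addNr mulr0 mul0r oppr0 !addr0.
Qed.

Lemma pos_subP f g : pos (f - g) <-> forall x, dot (g x) x <= dot (f x) x.
Proof.
by split=> fg x; have := fg x; rewrite !bopE !dotE subr_ge0.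
Qed.

(** Expand the positivity of [f] at [x - f x]; the term [dot (f (f x)) (f x)] is
    at most [dot (f x) (f x)]. *)
Lemma pos_contraction f x : pos f -> pos (1 - f) ->
  dot (f x) (f x) <= dot (f x) x.
Proof.
move=> f0 /pos_subP f1; have sf := pos_sa f0.
have := f0 (x - f x); rewrite !bop_lin !dotE (sf (f x)).
move: (f1 (f x)); rewrite bopE -subr_ge0 (sf (f x)) => le1 le2.
have := addr_ge0 le1 le2; rewrite -subr_ge0; congr (0 <= _); by ring.
Qed.

Hypothesis hdot : hilbert_dot dot.

Lemma bop_bound f :
  exists2 K, 0 < K & forall x, dot (f x) (f x) <= K * dot x x.
Proof.
have /linear_boundedP/pinfty_ex_gt0[K K0 Kf] : bounded_near f (nbhs 0).
  by apply/continuous_linear_bounded/bop_continuous.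
exists (K ^+ 2); first by rewrite exprn_gt0.
move=> x; rewrite -!hdot -exprMn; apply: lerXn2r; rewrite ?nnegrE ?Kf//.
by rewrite mulr_ge0// ltW.
Qed.

(** [2 * dot (f x) x <= dot (f x) (f x) + dot x x], since
    [dot (f x - x) (f x - x)] is nonnegative. *)
Lemma sa_le_scalar f : sa f -> exists2 K : C, 0 < K & pos (K *: (1 : bop) - f).
Proof.
move=> sf; have [K K0 Kf] := bop_bound f.
exists ((K + 1) / 2); first by rewrite divr_gt0 ?addr_gt0.
apply/pos_subP => x; rewrite !bopE dotZl.
rewrite -(@ler_pM2l _ 2)// mulrA mulrCA divff ?mulr1 ?pnatr_eq0//.
have := dot_ge0 dot (f x - x); rewrite !dotE -(sf x x) mulrDl mul1r => le1.
have := Kf x; rewrite -subr_ge0 => le2; rewrite -subr_ge0.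
have := addr_ge0 le1 le2; congr (0 <= _); by ring.
Qed.

(** Scaled down to a contraction, [f] satisfies
    [dot (f x) (f x) <= dot (f x) x]. *)
Lemma pos_ker f x : pos f -> dot (f x) x = 0 -> f x = 0.
Proof.
move=> f0 fx0; have [K K0 Kf] := sa_le_scalar (pos_sa f0).
have : dot ((K^-1 *: f) x) ((K^-1 *: f) x) <= dot ((K^-1 *: f) x) x.
  apply: pos_contraction.
    by move=> y; rewrite !bopE dotZl mulr_ge0// invr_ge0 ltW.
  apply/pos_subP => y; rewrite !bopE dotZl ler_pdivrMl//.
  by have /pos_subP/(_ y) := Kf; rewrite !bopE dotZl.
rewrite !bopE [leRHS]dotZl fx0 mulr0 => le0.
have /dot_eq0 /eqP : dot (K^-1 *: f x) (K^-1 *: f x) = 0.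
  by apply/le_anti; rewrite le0 dot_ge0.
by rewrite scaler_eq0 invr_eq0 gt_eqF//= => /eqP.
Qed.

Lemma dot_CauchySchwarz x y : `|dot x y| ^+ 2 <= dot x x * dot y y.
Proof.
have [->|y0] := eqVneq y 0; first by rewrite !dot0r normr0 expr0n mulr0.
have dy : 0 < dot y y by rewrite dnorm_gt0.
have := dot_ge0 dot (dot y y *: x - dot x y *: y).
rewrite !dotE (geC0_conj (ltW dy)) (dotC dot y x) !normCK.
set d := dot x y; set b := dot y y; set a := dot x x => le0.
rewrite -subr_ge0 -(pmulr_rge0 _ dy); move: le0; congr (0 <= _).
by rewrite -/b; ring.
Qed.

End Positive.

(** * Strong limits of contractions *)

Section StrongLimits.
Variables (R : realType) (H : completeNormedModType R[i]).
Variable dot : {dot H for @Num.conj R[i]}.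
Hypothesis hdot : hilbert_dot dot.
Local Notation C := R[i].
Local Notation toC := (real_complex R).
Local Notation bop := (bop H).
Local Notation sa f := (self_adjoint dot (bop_fun f)).
Local Notation pos f := (positive_operator dot (bop_fun f)).
Implicit Types (x y z : H) (f g h c d p q : bop).

Lemma dot_le_norm x y : `|dot x y| <= `|x| * `|y|.
Proof.
rewrite -(@ler_pXn2r _ 2)// ?nnegrE ?mulr_ge0// exprMn !hdot.
exact: dot_CauchySchwarz.
Qed.

(** The bounded monotone real sequence [beta] makes [u] a Cauchy sequence. Every
    strong limit taken below is obtained in this way. *)
Lemma cvg_of_monotone_dot (u : nat -> H) (beta : nat -> R) :
    (forall k, 0 <= beta k) ->
    (forall k m, (k <= m)%N ->
      dot (u m - u k) (u m - u k) <= toC (beta k - beta m)) ->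
  cvgn u.
Proof.
move=> beta0 ubeta.
have dec : nonincreasing_seq beta.
  move=> k m km; rewrite -subr_ge0 -(@lecR R).
  exact: le_trans (dot_ge0 _ _) (ubeta _ _ km).
have cb : cvgn beta.
  by apply: nonincreasing_is_cvgn => //; exists 0 => _ [k _ <-].
apply/cauchy_cvgP/cauchy_exP => e e0; set r := complex.Re e.
have er : e = toC r by rewrite [toC r]RRe_real ?gtr0_real.
have r0 : 0 < r by move: e0; rewrite er ltcR.
have lim_le m : limn beta <= beta m by exact: nonincreasing_cvgn_ge.
have /cvgrPdist_lt/(_ (r ^+ 2)) : beta @ \oo --> limn beta by [].
rewrite exprn_gt0// => /(_ isT)[N _ NP]; exists (u N).
exists N => // m /= Nm; rewrite -ball_normE /ball_/= -normrN opprB.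
rewrite -(@ltr_pXn2r _ 2)// ?nnegrE ?(ltW e0)// hdot.
apply: (le_lt_trans (ubeta _ _ Nm)); rewrite er -rmorphXn ltcR.
have NN := NP N (leqnn N); move: NN; rewrite /= distrC ger0_norm ?subr_ge0//.
by apply: le_lt_trans; rewrite lerD2l lerN2.
Qed.

Definition strong_limit (F : nat -> bop) g := forall x, F k x @[k --> \oo] --> g x.

Lemma exists_strong_limit (F : nat -> bop) :
    (forall k x, `|F k x| <= `|x|) -> (forall x, cvgn (fun k => F k x)) ->
  exists2 g, strong_limit F g & forall x, `|g x| <= `|x|.
Proof.
move=> F1 cF; pose G x := limn (fun k => F k x).
have FG x : F k x @[k --> \oo] --> G x by exact: cF.
have lG : linear G.
  move=> k x y; apply: (cvg_lim (@norm_hausdorff _ _)).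
  rewrite [X in X @ _ --> _](_ : _ = fun n => k *: F n x + F n y).
    by apply: cvgD; first apply: cvgZr; exact: FG.
  by apply: funext => n; rewrite !bop_lin.
have G1 x : `|G x| <= `|x|.
  apply/ler_addgt0Pr => e e0.
  have /cvgrPdist_lt/(_ e e0)[N _ /(_ N (leqnn N))/= NP] := FG x.
  rewrite -(subrK (F N x) (G x)) addrC (le_trans (ler_normD _ _))//.
  by rewrite lerD// ltW.
have bG : bounded_operator G.
  split=> //; pose Gl := GRing.isLinear.Build C H H *:%R G lG.
  pose Gll : {linear H -> H} := HB.pack G Gl.
  apply: (@bounded_linear_continuous _ _ _ Gll); apply/linear_boundedP.
  exists 1; split; first exact: rpred1.
  by move=> r r1 x; rewrite (le_trans (G1 x))// ler_peMl// ltW.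
by exists (Bop (introT (is_bopP G) bG)).
Qed.

Lemma strong_limit_unique (u : nat -> H) x y :
  u @ \oo --> x -> u @ \oo --> y -> x = y.
Proof. by move=> ux uy; rewrite -(cvg_lim _ ux)// -(cvg_lim _ uy). Qed.

(** With [g] ranging over the commutant of an operator [c], strong limits of
    elements of the bicommutant of [c] stay in it. *)
Lemma strong_limit_comm (F : nat -> bop) f g :
  strong_limit F f -> (forall k, GRing.comm g (F k)) -> GRing.comm g f.
Proof.
move=> Ff cgF; apply: bop_eqP => x; rewrite !bopE.
apply: (@strong_limit_unique (fun k => g (F k x))).
  by apply: continuous_cvg; [exact: bop_continuous | exact: Ff].
rewrite (_ : (fun k => _) = fun k => F k (g x)); first exact: Ff.
by apply: funext => k; rewrite -!bopME cgF.
Qed.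

Lemma strong_limit_sa (F : nat -> bop) f :
  strong_limit F f -> (forall k, sa (F k)) -> sa f.
Proof.
move=> Ff sF x y; apply/eqP; rewrite -subr_eq0 -normr_le0; apply/ler_addgt0Pr => e e0.
rewrite add0r; pose d := e / (`|x| + `|y| + 1).
have d1 : 0 < `|x| + `|y| + 1 by rewrite ltr_wpDl// addr_ge0.
have d0 : 0 < d by rewrite divr_gt0.
have /cvgrPdist_lt/(_ d d0)[N _ Nx] := Ff x.
have /cvgrPdist_lt/(_ d d0)[P _ Py] := Ff y.
pose n := maxn N P; have {}Nx := Nx n (leq_maxl _ _); have {}Py := Py n (leq_maxr _ _).
rewrite (_ : _ - _ = dot (f x - F n x) y - dot x (f y - F n y)); last first.
  by rewrite !dotE (sF n x y); ring.
apply: (le_trans (ler_normB _ _)).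
apply: (le_trans (lerD (dot_le_norm _ _) (dot_le_norm _ _))).
apply: (@le_trans _ _ (d * `|y| + `|x| * d)).
  by rewrite lerD// ?ler_wpM2r// ?ler_wpM2l// ltW.
rewrite (mulrC _ d) -mulrDr /d mulrAC ler_pdivrMr// ler_pM2l//.
by rewrite addrC lerDl.
Qed.

End StrongLimits.

(** * Self-adjoint operators and kernel projections *)

Section SelfAdjoint.
Variables (R : realType) (H : completeNormedModType R[i]).
Variable dot : {dot H for @Num.conj R[i]}.
Local Notation C := R[i].
Local Notation toC := (real_complex R).
Local Notation bop := (bop H).
Local Notation sa f := (self_adjoint dot (bop_fun f)).
Local Notation pos f := (positive_operator dot (bop_fun f)).
Implicit Types (x y z : H) (f g h c d p q : bop).

Lemma sa0 : sa (0 : bop).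
Proof. by move=> x y; rewrite !bopE dot0l dot0r. Qed.
Lemma sa1 : sa (1 : bop).
Proof. by []. Qed.
Lemma saD f g : sa f -> sa g -> sa (f + g).
Proof. by move=> sf sg x y; rewrite !bopE !dotE sf sg. Qed.
Lemma saN f : sa f -> sa (- f).
Proof. by move=> sf x y; rewrite !bopE !dotE sf. Qed.
Lemma saB f g : sa f -> sa g -> sa (f - g).
Proof. by move=> sf sg; apply/saD/saN. Qed.
Lemma saZ (k : C) f : k \is Num.real -> sa f -> sa (k *: f).
Proof. by move=> /CrealP kr sf x y; rewrite !bopE !dotE sf kr. Qed.
Lemma saM f g : sa f -> sa g -> GRing.comm f g -> sa (f * g).
Proof. by move=> sf sg fg x y; rewrite {2}fg !bopE sf sg. Qed.
Lemma saX f n : sa f -> sa (f ^+ n).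
Proof.
move=> sf; elim: n => [|n IH]; first exact: sa1.
by rewrite exprS; apply: saM => //; exact: commrX.
Qed.

Lemma pos1 : pos (1 : bop).
Proof. by move=> x; exact: dot_ge0. Qed.
Lemma posZ (k : C) f : 0 <= k -> pos f -> pos (k *: f).
Proof. by move=> k0 f0 x; rewrite !bopE dotZl mulr_ge0. Qed.
Lemma posD f g : pos f -> pos g -> pos (f + g).
Proof. by move=> f0 g0 x; rewrite !bopE dotDl addr_ge0. Qed.
Lemma pos_conj g f : sa g -> pos f -> pos (g * f * g).
Proof. by move=> sg f0 x; rewrite !bopE sg. Qed.
Lemma pos_sqr f : sa f -> pos (f * f).
Proof. by move=> sf x; rewrite bopE sf dot_ge0. Qed.
Lemma posX f n : pos f -> pos (f ^+ n).
Proof.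
move=> f0; have sf := pos_sa f0.
rewrite -[n]odd_double_half addnC -addnn -addnA (addnC n./2 (odd n)) !exprD mulrA.
apply: pos_conj; first exact: saX.
by case: odd; [rewrite expr1 | exact: pos1].
Qed.

(** Membership of [f] in the bicommutant of [c]. *)
Definition bicomm c f := forall g, GRing.comm g c -> GRing.comm g f.

Lemma comm_scale (k : C) f g : GRing.comm g f -> GRing.comm g (k *: f).
Proof. by rewrite /GRing.comm -bop_scaleAr -bop_scaleAl => ->. Qed.

Definition is_proj p := p * p = p /\ sa p.

Hypothesis hdot : hilbert_dot dot.

Lemma contraction_norm f x : pos f -> pos (1 - f) -> `|f x| <= `|x|.
Proof.
move=> f0 f1; rewrite -(@ler_pXn2r _ 2)// ?nnegrE// !hdot.
apply: (le_trans (pos_contraction x f0 f1)).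
by have /pos_subP/(_ x) := f1.
Qed.

Lemma scale_to_contraction f : pos f ->
  exists K : C, [/\ 0 < K, pos (K^-1 *: f) & pos (1 - K^-1 *: f)].
Proof.
move=> f0; have [K K0 Kf] := sa_le_scalar hdot (pos_sa f0); exists K.
split=> //; first by apply: posZ => //; rewrite invr_ge0 ltW.
have -> : 1 - K^-1 *: f = K^-1 *: (K *: (1 : bop) - f).
  by rewrite scalerBr scalerA mulVf ?gt_eqF// scale1r.
by apply: posZ => //; rewrite invr_ge0 ltW.
Qed.

Lemma sqr_ker f x : sa f -> f (f x) = 0 -> f x = 0.
Proof. by move=> sf ff0; apply: (@dot_eq0 _ _ dot); rewrite sf ff0 dot0r. Qed.

Section KernelProjection.
Variable d : bop.
Hypothesis sd : sa d.

Let dec_form (T : bop) (K : C) x : 0 < K -> T = 1 - K^-1 *: (d * d) ->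
  pos T -> forall n, dot ((T ^+ n.+1) x) x <= dot ((T ^+ n) x) x.
Proof.
move=> K0 Tdef T0 n; have cT : GRing.comm d T.
  rewrite Tdef; apply: commrB; first exact: commr1.
  by apply: comm_scale; exact: commrM.
rewrite -subr_ge0 -dotNl -dotDl -bopNE -bopDE.
have T1 : 1 - T = K^-1 *: (d * d) by rewrite Tdef opprB addrC subrK.
rewrite exprSr -[X in X - _]mulr1 -mulrBr T1.
rewrite -bop_scaleAr mulrA -(commrX n cT).
by apply: posZ; [rewrite invr_ge0 ltW | apply/pos_conj/posX].
Qed.

(** The powers of [T = 1 - d^2 / K] decrease, [K] being chosen with
    [0 <= T <= 1]. They converge strongly to the projection onto the fixed points
    of [T], that is onto the kernel of [d]. *)
Lemma exists_kernel_projection : exists q,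
  [/\ is_proj q, d * q = 0, (forall x, d x = 0 -> q x = x) & bicomm d q].
Proof.
have [K [K0 A0 T0]] := scale_to_contraction (pos_sqr sd).
pose T := 1 - K^-1 *: (d * d); rewrite -/T in T0.
have dec := dec_form _ K0 erefl T0.
have cT g : GRing.comm g d -> GRing.comm g T.
  move=> gd; apply: commrB; first exact: commr1.
  by apply: comm_scale; exact: commrM.
have T1 x : `|T x| <= `|x|.
  by apply: contraction_norm => //; rewrite opprB addrC subrK.
pose F n : bop := T ^+ n.
have F1 n x : `|F n x| <= `|x|.
  by elim: n => [|n IH]//; rewrite /F exprS bopE (le_trans (T1 _)).
pose al x n := complex.Re (dot (F n x) x).
have alE x n : toC (al x n) = dot (F n x) x.
  by rewrite [LHS]RRe_real// ger0_real// posX.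
have al_dec x : {homo al x : m n / (m <= n)%N >-> n <= m}.
  by apply/nonincreasing_seqP => n; rewrite -(@lecR R) !alE dec.
have cvF x : cvgn (fun k => F k x).
  apply: (@cvg_of_monotone_dot _ _ dot hdot _ (fun k => al x k.*2)).
    by move=> k; rewrite -(@lecR R) alE posX.
  move=> k m km; have sF n := saX n (pos_sa T0).
  have mulF i j : dot (F i x) (F j x) = toC (al x (i + j)%N).
    by rewrite alE addnC [F (j + i)%N]exprD bopE (sF j).
  rewrite !dotE !mulF (addnC k m) -!rmorphN -!rmorphD lecR -!addnn.
  by have := al_dec x _ _ (leq_add (leqnn m) km); lra.
have [q Fq q1] := exists_strong_limit F1 cvF.
have Tq : T * q = q.
  apply: bop_eqP => x; rewrite bopE.
  apply: (@strong_limit_unique _ _ (fun k => T (F k x))).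
    by apply: continuous_cvg; [exact: bop_continuous | exact: Fq].
  rewrite (_ : (fun k => _) = fun k => F k.+1 x).
    by rewrite (cvg_shiftS (fun k => F k x)); exact: Fq.
  by apply: funext => k; rewrite /F exprS.
have dq : d * q = 0.
  apply: bop_eqP => x; rewrite !bopE; apply: sqr_ker => //.
  have := congr1 (fun f : bop => f x) Tq; rewrite /T !bopE => /eqP.
  rewrite addrC -subr_eq0 addrK oppr_eq0 scaler_eq0 invr_eq0 gt_eqF//=.
  by move/eqP.
have dker x : d x = 0 -> q x = x.
  move=> dx; apply: (@strong_limit_unique _ _ (fun k => F k x)); first exact: Fq.
  rewrite (_ : (fun k => _) = cst x); first exact: cvg_cst.
  apply: funext => k; elim: k => [|k IH]//.
  by rewrite /F exprS bopE -/(F k) IH /T !bopE dx bop_lin scaler0 subr0.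
exists q; split=> //; first split.
- apply: bop_eqP => x; rewrite bopE; apply: dker.
  by rewrite -bopME dq.
- by apply: (strong_limit_sa hdot Fq) => k; apply/saX/pos_sa.
- by move=> g gd; apply: (strong_limit_comm Fq) => k; apply/commrX/cT.
Qed.

End KernelProjection.
End SelfAdjoint.

(** * Square roots and spectral projections *)

Section SquareRoot.
Variables (R : realType) (H : completeNormedModType R[i]).
Variable dot : {dot H for @Num.conj R[i]}.
Hypothesis hdot : hilbert_dot dot.
Local Notation C := R[i].
Local Notation toC := (real_complex R).
Local Notation bop := (bop H).
Local Notation sa f := (self_adjoint dot (bop_fun f)).
Local Notation pos f := (positive_operator dot (bop_fun f)).
Implicit Types (x y z : H) (f g h c d p q : bop).

(** The iteration [Y |-> (f + Y^2) / 2], started at [0]: at a fixed point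
    [(1 - Y)^2 = 1 - f]. *)
Fixpoint sqrt_approx f n : bop :=
  if n is m.+1 then 2^-1 *: (f + sqrt_approx f m * sqrt_approx f m) else 0.

(** The same iteration for the scalar [f = 1]. It dominates the norms of the
    approximants and of their increments, because the approximants commute with
    one another. *)
Fixpoint sqrt_bound n : R :=
  if n is m.+1 then 2^-1 * (1 + sqrt_bound m ^+ 2) else 0.

Lemma sqrt_bound_itv n : 0 <= sqrt_bound n <= 1.
Proof.
elim: n => [|n /andP[le0 le1]] /=; first by rewrite lexx ler01.
by apply/andP; split; nra.
Qed.

Lemma sqrt_bound_inc n : sqrt_bound n <= sqrt_bound n.+1.
Proof. by move=> /=; have := sqr_ge0 (sqrt_bound n - 1); lra. Qed.

Lemma sqrt_bound_homo : {homo sqrt_bound : m n / (m <= n)%N >-> m <= n}.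
Proof. by apply/nondecreasing_seqP => n; exact: sqrt_bound_inc. Qed.

Section Contraction.
Variable f : bop.
Hypotheses (f0 : pos f) (f1 : pos (1 - f)).
Local Notation Y := (sqrt_approx f).

Lemma comm_sqrt_approx g n : GRing.comm g f -> GRing.comm g (Y n).
Proof.
move=> gf; elim: n => [|n IH] /=; first exact: commr0.
by apply: comm_scale; apply: commrD => //; exact: commrM.
Qed.

Let normY n x : `|Y n x| <= toC (sqrt_bound n) * `|x|.
Proof.
elim: n x => [|n IH] x; first by rewrite bopE normr0 rmorph0 mul0r.
rewrite [Y n.+1]/= !bopE [sqrt_bound n.+1]/= normrZ ger0_norm ?invr_ge0// rmorphM fmorphV rmorph_nat -mulrA.
rewrite ler_pM2l ?invr_gt0// rmorphD rmorph1 rmorphXn mulrDl mul1r.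
rewrite (le_trans (ler_normD _ _))// lerD//.
  exact: (contraction_norm hdot).
rewrite (le_trans (IH _))// expr2 -mulrA ler_wpM2l// (@lecR R 0).
by case/andP: (sqrt_bound_itv n).
Qed.

Let stepY n x :
  `|Y n.+1 x - Y n x| <= toC (sqrt_bound n.+1 - sqrt_bound n) * `|x|.
Proof.
elim: n x => [|n IH] x.
  by have := normY 1 x; rewrite -[sqrt_bound 0]/(0 : R) !subr0.
have cY : Y n.+1 * Y n = Y n * Y n.+1.
  by apply: comm_sqrt_approx; apply/commr_sym/comm_sqrt_approx.
have -> : Y n.+2 x - Y n.+1 x = 2^-1 *: (Y n.+1 - Y n) ((Y n.+1 + Y n) x).
  rewrite -!bopME -bopZE -bopNE -bopDE; congr (bop_fun _ x).
  rewrite [Y n.+2]/= [X in _ - X]/= -/(Y n) -/(Y n.+1) -scalerBr; congr (_ *: _).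
  by rewrite mulrDr !mulrBl cY opprD addrACA subrr add0r addrA subrK.
have -> : sqrt_bound n.+2 - sqrt_bound n.+1 =
    2^-1 * ((sqrt_bound n.+1 - sqrt_bound n) * (sqrt_bound n.+1 + sqrt_bound n)).
  rewrite -[sqrt_bound n.+2]/(2^-1 * (1 + sqrt_bound n.+1 ^+ 2)).
  have : sqrt_bound n.+1 = 2^-1 * (1 + sqrt_bound n ^+ 2) by [].
  by move: (sqrt_bound n.+1) (sqrt_bound n) => b b'; lra.
rewrite normrZ ger0_norm ?invr_ge0// !rmorphM fmorphV rmorph_nat -!mulrA.
rewrite ler_pM2l ?invr_gt0// bopDE bopNE (le_trans (IH _))// ler_wpM2l//.
  by rewrite (@lecR R 0) subr_ge0 sqrt_bound_inc.
rewrite bopDE rmorphD mulrDl (le_trans (ler_normD _ _))//.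
by rewrite lerD//; exact: normY.
Qed.

Let distY m n x : (m <= n)%N ->
  `|Y n x - Y m x| <= toC (sqrt_bound n - sqrt_bound m) * `|x|.
Proof.
elim: n => [|n IH]; first by rewrite leqn0 => /eqP->; rewrite !subrr normr0 rmorph0 mul0r.
rewrite leq_eqVlt => /orP[/eqP->|/IH {}IH].
  by rewrite !subrr normr0 rmorph0 mul0r.
rewrite -(subrKA (Y n x)) (le_trans (ler_normD _ _))//.
rewrite -(subrKA (sqrt_bound n)) rmorphD mulrDl lerD//; exact: stepY.
Qed.

Lemma exists_sqrt_contraction : exists e,
  [/\ pos e, e * e = 1 - f & bicomm f e].
Proof.
have Y1 n x : `|Y n x| <= `|x|.
  rewrite (le_trans (normY n x))// ler_piMl// (@lecR R _ 1).
  by case/andP: (sqrt_bound_itv n).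
have cvY x : cvgn (fun n => Y n x).
  pose a := complex.Re (dot x x).
  have aE : toC a = dot x x by rewrite [LHS]RRe_real// ger0_real// dot_ge0.
  have a0 : 0 <= a by rewrite -(@lecR R) aE dot_ge0.
  apply: (@cvg_of_monotone_dot _ _ dot hdot _ (fun n => (1 - sqrt_bound n) * a)).
    move=> n; rewrite mulr_ge0// subr_ge0.
    by case/andP: (sqrt_bound_itv n).
  move=> m n mn; rewrite -hdot.
  have -> : (1 - sqrt_bound m) * a - (1 - sqrt_bound n) * a =
      (sqrt_bound n - sqrt_bound m) * a by ring.
  rewrite rmorphM /= aE -hdot.
  apply: (@le_trans _ _ ((toC (sqrt_bound n - sqrt_bound m) * `|x|) ^+ 2)).
    apply: lerXn2r; rewrite ?nnegrE ?distY// mulr_ge0//.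
    by rewrite (@lecR R 0) subr_ge0 sqrt_bound_homo.
  rewrite exprMn ler_wpM2r// -rmorphXn lecR.
  have := sqrt_bound_homo mn; have /andP[_] := sqrt_bound_itv n.
  have /andP[+ _] := sqrt_bound_itv m; nra.
have [g Yg g1] := exists_strong_limit Y1 cvY.
have sg : sa g.
  apply: (strong_limit_sa hdot Yg); elim=> [|n IH]; first exact: sa0.
  apply: saZ; first by rewrite rpredV realn.
  by apply: saD; [exact: pos_sa | exact: saM].
have gE : g = 2^-1 *: (f + g * g).
  apply: bop_eqP => x; apply: (@strong_limit_unique _ _ (fun n => Y n.+1 x)).
    by rewrite (cvg_shiftS (fun n => Y n x)); exact: Yg.
  rewrite !bopE; apply: cvgZr; apply: cvgD; first exact: cvg_cst.
  have Ygg : Y n (g x) @[n --> \oo] --> g (g x) by exact: Yg.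
  rewrite (_ : (fun _ => _) = fun n => Y n (Y n x - g x) + Y n (g x)); last first.
    by apply: funext => n; rewrite -bop_lin subrK.
  rewrite -[X in _ --> X]add0r; apply: cvgD => //.
  apply/cvgr0Pnorm_lt => e e0.
  have /cvgrPdist_lt/(_ e e0) := Yg x; apply: filterS => n; rewrite distrC.
  exact: le_lt_trans.
exists (1 - g); split.
- apply/pos_subP => x; rewrite bop1E.
  have gr : dot (g x) x \is Num.real by apply/CrealP; rewrite -dotC -sg.
  rewrite (le_trans (real_ler_norm gr))// (le_trans (dot_le_norm hdot _ _))//.
  by rewrite -hdot expr2 ler_wpM2r.
- have g2 : g *+ 2 = f + g * g.
    by rewrite -scaler_nat {1}gE scalerA divff ?scale1r// pnatr_eq0.
  have {1}-> : f = g *+ 2 - g * g by rewrite g2 addrK.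
  rewrite mulrBr mulr1 mulrBl mul1r mulr2n !opprB opprD !addrA.
  by congr (_ - _); rewrite addrAC.
- move=> h hf; apply: commrB; first exact: commr1.
  by apply: (strong_limit_comm Yg) => n; exact: comm_sqrt_approx.
Qed.

End Contraction.

Lemma exists_sqrt f : pos f -> exists e, [/\ pos e, e * e = f & bicomm f e].
Proof.
move=> f0; have [K [K0 p0 p1]] := scale_to_contraction hdot f0.
have [|e [e0 ee ce]] := @exists_sqrt_contraction (1 - K^-1 *: f) p1.
  by rewrite opprB addrC subrK.
exists (sqrtC K *: e); split.
- by apply: posZ => //; rewrite sqrtC_ge0 ltW.
- rewrite -bop_scaleAr -bop_scaleAl scalerA -expr2 sqrtCK ee opprB addrC subrK.
  by rewrite scalerA divff ?gt_eqF// scale1r.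
- move=> g gf; apply/comm_scale/ce; apply: commrB; first exact: commr1.
  exact: comm_scale.
Qed.

(** [spec_proj c p] says that [p] is the spectral projection of [c] for the
    open half-line of positive reals; the last clause is what keeps the kernel of
    [c] out of the range of [p]. *)
Definition spec_proj c p := [/\ is_proj dot p, bicomm c p,
  pos (c * p), pos (- (c * (1 - p))) & forall x, c (p x) = 0 -> p x = 0].

(** With [e] the absolute value of [c], let [p] be the complement of the kernel
    projection [q] of [d = e + c]. As [d * (e - c) = 0], the range of [e - c] lies
    in that of [q]; so [c] is [e] on the range of [p] and [- e] on that of [q]. *)
Lemma exists_spec_proj c : sa c -> exists p, spec_proj c p.
Proof.
move=> sc; have [e [e0 ee ce]] := exists_sqrt (pos_sqr sc).
have se := pos_sa e0.
have {}ce g : GRing.comm g c -> GRing.comm g e.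
  by move=> gc; apply: ce; exact: commrM.
have cec : GRing.comm c e by exact: ce.
pose d := e + c; pose d' := e - c.
have sd : sa d by exact: saD.
have [q [[qq sq] dq qker cq]] := exists_kernel_projection hdot sd.
have qd : q * d = 0 by rewrite -(cq d (commr_refl d)).
have {}cq g : GRing.comm g c -> GRing.comm g q.
  by move=> gc; apply: cq; apply: commrD => //; exact: ce.
have qd' : q * d' = d'.
  apply: bop_eqP => x; rewrite bopE; apply: qker; rewrite -bopME.
  by rewrite /d /d' mulrDl !mulrBr ee cec -[X in _ + X]opprB subrr.
have eq : GRing.comm q e by apply/ce/commr_sym/cq.
have dd' : d + d' = e *+ 2 by rewrite /d /d' addrACA subrr addr0 mulr2n.
have d'E : d' = (q * e * q) *+ 2.
  by rewrite -mulrA -eq mulrA qq -mulrnAr -dd' mulrDr qd qd' add0r.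
have qc : q * c = - (q * e).
  by apply/eqP; rewrite -addr_eq0 addrC -mulrDr qd.
pose p := 1 - q; have cp : GRing.comm c p by apply: commrB; [exact: commr1 | exact: cq].
have pp : p * p = p by rewrite /p mulrBr mulr1 mulrBl mul1r qq subrr subr0.
have sp : sa p by apply: saB.
have pc : p * c = p * e.
  apply/eqP; rewrite -subr_eq0 -mulrBr -[X in _ * X]opprB mulrN oppr_eq0.
  by rewrite -/d' /p mulrBl mul1r qd' subrr.
have pe : GRing.comm p e by apply/commr_sym/commrB; [exact: commr1 | exact/commr_sym].
exists p; split; first by split.
- by move=> g gc; apply: commrB; [exact: commr1 | exact: cq].
- rewrite cp pc -pp -mulrA pe mulrA; exact: pos_conj.
- have -> : 1 - p = q by rewrite /p opprB addrC subrK.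
  rewrite cq// qc opprK -qq -mulrA eq mulrA.
  exact: pos_conj.
- move=> x cpx; have ep : e * p = c * p by rewrite -pe -pc -cp.
  have dp : d * p = d by rewrite /p mulrBr mulr1 dq subr0.
  rewrite /p !bopE qker ?subrr// -dp bopE /d bopDE -bopME ep bopME cpx.
  by rewrite addr0.
Qed.

End SquareRoot.

(** * Resolutions of the identity *)

Section Resolutions.
Variables (R : realType) (H : completeNormedModType R[i]).
Variable dot : {dot H for @Num.conj R[i]}.
Hypothesis hdot : hilbert_dot dot.
Local Notation C := R[i].
Local Notation toC := (real_complex R).
Local Notation bop := (bop H).
Local Notation sa f := (self_adjoint dot (bop_fun f)).
Local Notation pos f := (positive_operator dot (bop_fun f)).
Implicit Types (x y z : H) (f g h c d p q : bop).

Lemma toC_real (r : R) : toC r \is Num.real.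
Proof. by apply/complex_realP; exists r. Qed.

Lemma proj_compl p : is_proj dot p -> is_proj dot (1 - p).
Proof.
move=> [pp sp]; split; last exact: saB.
by rewrite mulrBr mulr1 mulrBl mul1r pp subrr subr0.
Qed.

Lemma proj_mul p q :
  is_proj dot p -> is_proj dot q -> GRing.comm p q -> is_proj dot (p * q).
Proof.
move=> [pp sp] [qq sq] pq; split; last exact: saM.
by rewrite -mulrA (mulrA q) -pq -mulrA qq mulrA pp.
Qed.

Lemma proj_pos p : is_proj dot p -> pos p.
Proof. by move=> [pp sp]; rewrite -pp; exact: pos_sqr. Qed.

Definition resolution (I : finType) (q : I -> bop) :=
  [/\ forall i, is_proj dot (q i), forall i j, i != j -> q i * q j = 0 &
      \sum_i q i = 1].

(** [q] lies under [p] or under its complement. *)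
Definition decides p q := p * q = q \/ p * q = 0.

(** If each spectral projection of [c] restricts to [0] or to the identity on
    the range of [q], the numerical range of [c] there lies on one side of every
    real number: it is a single point. *)
Lemma scalar_of_decided c q : sa c -> is_proj dot q -> GRing.comm c q ->
    (forall s, exists2 p, spec_proj dot (c - toC s *: (1 : bop)) p & decides p q) ->
  exists l, c * q = toC l *: q.
Proof.
move=> sc pq cq dec; have [qq sq] := pq.
have sqcq : sa (c * q) by exact: saM.
pose form z := complex.Re (dot (c (q z)) (q z)).
pose nrm z := complex.Re (dot (q z) (q z)).
have formE z : toC (form z) = dot (c (q z)) (q z).
  by rewrite [LHS]RRe_real//; apply/CrealP; rewrite -dotC sc.
have nrmE z : toC (nrm z) = dot (q z) (q z).
  by rewrite [LHS]RRe_real// ger0_real// dot_ge0.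
have side s : (forall z, s * nrm z <= form z) \/ (forall z, form z <= s * nrm z).
  have [p [_ _ p1 p2 _] [pq1|pq0]] := dec s; [left|right] => z;
    rewrite -(@lecR R) rmorphM /= nrmE formE -dotZl -subr_ge0.
    have := p1 (q z); rewrite bopME -[p (q z)]bopME pq1.
    by rewrite !bopE dotDl dotNl.
  have := p2 (q z); rewrite bopNE bopME !bopE -[p (q z)]bopME pq0 bop0E subr0.
  by rewrite opprB dotDl dotNl.
have [[x qx0]|q0] := pselect (exists x, q x != 0); last first.
  exists 0; rewrite scale0r (_ : q = 0) ?mulr0//; apply: bop_eqP => x.
  by apply/eqP; apply: contrapT => qx; apply: q0; exists x; apply/negP.
have nrm_gt0 z : q z != 0 -> 0 < nrm z.
  by move=> qz; rewrite -(@ltcR R) nrmE dnorm_gt0.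
pose l := form x / nrm x.
have formx : form x = l * nrm x by rewrite divfK// gt_eqF// nrm_gt0.
have form_l z : form z = l * nrm z.
  have [qz0|qz] := eqVneq (q z) 0.
    by apply: (@complexI R); rewrite rmorphM /= formE nrmE qz0 !dot0r mulr0.
  have nz := nrm_gt0 _ qz; have nx := nrm_gt0 _ qx0.
  pose lz := form z / nrm z.
  have formz : form z = lz * nrm z by rewrite divfK// gt_eqF.
  rewrite formz; congr (_ * _).
  by have [sd|sd] := side ((l + lz) / 2); have := sd x; have := sd z;
    rewrite formx formz !ler_pM2r//; lra.
exists l; apply/eqP; rewrite -subr_eq0; apply/eqP.
have form0 z : dot ((c * q - toC l *: q) z) z = 0.
  have -> : c * q - toC l *: q = q * (c * q - toC l *: q).
    by rewrite mulrBr mulrA -cq -mulrA -bop_scaleAr qq.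
  rewrite bopME sq !bopE dotDl dotNl dotZl -formE -nrmE form_l.
  by rewrite rmorphM subrr.
by apply: bop_eqP => z; apply: (pos_ker hdot) => // y; rewrite form0.
Qed.

(** The atoms of the Boolean algebra generated by commuting projections: each new
    projection splits every atom in two, possibly with a zero part. *)
Lemma exists_atoms (L : seq bop) :
    {in L, forall p, is_proj dot p} -> {in L &, forall p q, GRing.comm p q} ->
  exists (I : finType) (q : I -> bop), [/\ resolution q,
    {in L, forall p i, decides p (q i)} &
    forall g, {in L, forall p, GRing.comm g p} -> forall i, GRing.comm g (q i)].
Proof.
elim: L => [|p L IH] Lp Lc.
  exists unit, (fun=> 1); split=> //; last by move=> *; exact: commr1.
  split; first by split; [exact: mul1r | exact: sa1].
    by case=> -[].
  by rewrite (bigD1 tt)//= big1 ?addr0//; case.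
have [|r s rL sL|I [q [[qp qo q1] qd qc]]] := IH.
- by move=> r rL; apply: Lp; rewrite inE rL orbT.
- by apply: Lc; rewrite inE ?rL ?sL orbT.
have pp : is_proj dot p by apply: Lp; rewrite mem_head.
have pc i : GRing.comm p (q i).
  by apply: qc => r rL; apply: Lc; rewrite ?mem_head// inE rL orbT.
pose e (b : bool) := if b then p else 1 - p.
have ep b : is_proj dot (e b) by case: b => //; exact: proj_compl.
have ec b i : GRing.comm (e b) (q i).
  case: b => //=; apply/commr_sym/commrB; first exact: commr1.
  exact: commr_sym.
have [pp1 _] := pp.
have eo b b' : b != b' -> e b * e b' = 0.
  case: b b' => -[]//= _; first by rewrite mulrBr mulr1 pp1 subrr.
  by rewrite mulrBl mul1r pp1 subrr.
exists (I * bool)%type, (fun ib => e ib.2 * q ib.1); split; first split.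
- by move=> [i b]; apply: proj_mul.
- move=> [i b] [j b'] /= ne; rewrite -mulrA (mulrA (q i)) -ec.
  rewrite -mulrA mulrA; have [ij|ij] := eqVneq i j; last by rewrite qo ?mulr0.
  by rewrite eo ?mul0r//; apply: contra_neq ne => ->; rewrite ij.
- rewrite -(pair_bigA _ (fun i b => e b * q i))/=.
  rewrite -q1; apply: eq_bigr => i _.
  by rewrite big_bool /= -mulrDl addrC subrK mul1r.
- move=> r; rewrite inE => /predU1P[->|rL] [i b] /=.
    by case: b => /=; [left; rewrite mulrA pp1|
      right; rewrite mulrA mulrBr mulr1 pp1 subrr mul0r].
  have re : GRing.comm r (e b).
    have rp : GRing.comm r p by apply: Lc; rewrite ?mem_head// inE rL orbT.
    by case: b => //=; apply: commrB; first exact: commr1.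
  rewrite /decides mulrA re -mulrA.
  by have [->|->] := qd _ rL i; [left | right; rewrite mulr0].
- move=> g gL [i b]; apply: commrM => /=.
    have gp : GRing.comm g p by apply: gL; rewrite mem_head.
    by case: b => //=; apply: commrB; first exact: commr1.
  by apply: qc => r rL; apply: gL; rewrite inE rL orbT.
Qed.

Definition spec_proj_of c p := exists s : R, spec_proj dot (c - toC s *: (1 : bop)) p.

Lemma comm_shift g c (s : R) : GRing.comm g c -> GRing.comm g (c - toC s *: (1 : bop)).
Proof. by move=> gc; apply: commrB => //; apply: comm_scale; exact: commr1. Qed.

Lemma sa_shift c (s : R) : sa c -> sa (c - toC s *: (1 : bop)).
Proof. by move=> sc; apply: saB => //; apply: saZ; [exact: toC_real | exact: sa1]. Qed.

Lemma spec_proj_of_bicomm c p : spec_proj_of c p -> bicomm c p.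
Proof. by move=> [s [_ cp _ _ _]] g gc; apply: cp; exact: comm_shift. Qed.

Lemma spec_proj_of_proj c p : spec_proj_of c p -> is_proj dot p.
Proof. by case=> s []. Qed.

Lemma spec_proj_of_comm c c' p p' : GRing.comm c c' ->
  spec_proj_of c p -> spec_proj_of c' p' -> GRing.comm p p'.
Proof.
move=> cc' /spec_proj_of_bicomm cp /spec_proj_of_bicomm cp'.
by apply/cp'/commr_sym/cp/commr_sym.
Qed.

Lemma simultaneous_resolution (J : Type) (c : J -> bop) (L : seq bop) :
    (forall j, sa (c j)) -> (forall i j, GRing.comm (c i) (c j)) ->
    (forall p, p \in L <-> exists j, spec_proj_of (c j) p) ->
  exists (I : finType) (q : I -> bop), [/\ resolution q,
    forall j i, exists l : R, c j * q i = toC l *: q i &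
    forall g, {in L, forall p, GRing.comm g p} -> forall i, GRing.comm g (q i)].
Proof.
move=> sc cc LP.
have [|p p' /LP[j jp] /LP[j' jp']|I [q [rq qd qc]]] := @exists_atoms L.
- by move=> p /LP[j]; exact: spec_proj_of_proj.
- exact: spec_proj_of_comm (cc j j') jp jp'.
exists I, q; split=> // j i; have [qp _ _] := rq; apply: scalar_of_decided => //.
  by apply: qc => p /LP[j' /spec_proj_of_bicomm]; apply; exact: cc.
move=> s; have [p ps] := exists_spec_proj hdot (sa_shift s (sc j)).
by exists p => //; apply: qd; apply/LP; exists j, s.
Qed.

Lemma resolution_expand (I : finType) (q : I -> bop) c (l : I -> C) :
  resolution q -> (forall i, c * q i = l i *: q i) -> c = \sum_i l i *: q i.
Proof.
move=> [_ _ q1] cl; rewrite -[LHS]mulr1 -q1 mulr_sumr.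
by apply: eq_bigr => i _; exact: cl.
Qed.

Lemma comm_sum (I : finType) (F : I -> bop) g :
  (forall i, GRing.comm g (F i)) -> GRing.comm g (\sum_i F i).
Proof.
move=> gF; rewrite /GRing.comm mulr_sumr mulr_suml.
by apply: eq_bigr => i _; exact: gF.
Qed.

(** [c] is a linear combination of the atoms of its spectral projections. *)
Lemma comm_of_spec_proj c (L : seq bop) g : sa c ->
    (forall p, p \in L <-> spec_proj_of c p) ->
  {in L, forall p, GRing.comm g p} -> GRing.comm g c.
Proof.
move=> sc LP gL.
have [||p|I [q [rq ql qc]]] := @simultaneous_resolution unit (fun=> c) L.
- by [].
- by [].
- by rewrite LP; split=> [|[]//]; exists tt.
have [l cl] := choice (ql tt).
rewrite (resolution_expand (l := fun i => toC (l i)) rq cl).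
by apply: comm_sum => i; apply/comm_scale/qc.
Qed.

End Resolutions.

(** * Spectral projections give extreme points *)

Section VonNeumann.
Variables (R : realType) (H : completeNormedModType R[i]).
Variable dot : {dot H for @Num.conj R[i]}.
Hypothesis hdot : hilbert_dot dot.
Local Notation C := R[i].
Local Notation toC := (real_complex R).
Local Notation bop := (bop H).
Local Notation sa f := (self_adjoint dot (bop_fun f)).
Local Notation pos f := (positive_operator dot (bop_fun f)).
Implicit Types (x y z : H) (a f g h c d p q : bop).

(** The part of being a von Neumann algebra that bears on single operators: it
    yields closure under the ring operations as well as under the square root and
    spectral projection constructions. *)
Definition bicommutant_closed (A : set (H -> H)) :=
  (forall f : H -> H, A f -> bounded_operator f) /\
  forall f, (forall g, (forall h, A h -> GRing.comm g h) -> GRing.comm g f) -> A f.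

Lemma von_neumann_bicommutant A : von_neumann_algebra dot A -> bicommutant_closed A.
Proof.
move=> [_ AA]; split=> [f|f fc]; first by rewrite -AA => -[].
rewrite -AA; split; first exact/is_bopP/bopP.
move=> g [bg gA]; have := fc (Bop (introT (is_bopP g) bg)).
rewrite /GRing.comm => gf; apply/esym.
have /gf E h : A h -> Bop (introT (is_bopP g) bg) * h = h * Bop (introT (is_bopP g) bg).
  by move=> Ah; apply: bop_eqP => x; have /(congr1 (@^~ x)) := gA _ Ah.
exact: (congr1 (@bop_fun R H) E).
Qed.

Lemma bicommutant_lift A (f : H -> H) : bicommutant_closed A -> A f ->
  exists2 g : bop, bop_fun g = f & A g.
Proof. by move=> [Ab _] Af; exists (Bop (introT (is_bopP f) (Ab f Af))). Qed.

Section Closure.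
Variable A : set (H -> H).
Hypothesis hA : bicommutant_closed A.

Lemma memA1 : A (1 : bop).
Proof. by apply hA.2 => g _; exact: commr1. Qed.
Lemma memA0 : A (0 : bop).
Proof. by apply hA.2 => g _; exact: commr0. Qed.
Lemma memAD f g : A f -> A g -> A (f + g).
Proof. by move=> Af Ag; apply hA.2 => h hh; apply: commrD; exact: hh. Qed.
Lemma memAB f g : A f -> A g -> A (f - g).
Proof. by move=> Af Ag; apply hA.2 => h hh; apply: commrB; exact: hh. Qed.
Lemma memAM f g : A f -> A g -> A (f * g).
Proof. by move=> Af Ag; apply hA.2 => h hh; apply: commrM; exact: hh. Qed.
Lemma memAZ k f : A f -> A (k *: f).
Proof. by move=> Af; apply hA.2 => h hh; apply: comm_scale; exact: hh. Qed.
Lemma memA_sum (I : finType) (F : I -> bop) : (forall i, A (F i)) -> A (\sum_i F i).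
Proof. by move=> AF; apply hA.2 => h hh; apply: comm_sum => i; exact: hh. Qed.
Lemma memA_bicomm c f : A c -> bicomm c f -> A f.
Proof. by move=> Ac cf; apply hA.2 => h hh; apply: cf; exact: hh. Qed.

End Closure.

Lemma sa_mul0 f g : sa f -> sa g -> f * g = 0 -> g * f = 0.
Proof.
move=> sf sg fg; apply: bop_eqP => x; apply: (@dot_ext _ _ dot) => y.
by rewrite !bopE dot0l sg sf -bopME fg bop0E dot0r.
Qed.

Section Trace.
Variables (M : set (H -> H)) (tau : (H -> H) -> C).
Hypothesis hM : bicommutant_closed M.
Hypotheses (htau : state dot M tau) (trtau : tracial M tau)
  (fatau : faithful dot M tau).

Lemma tau_linear k f g : M f -> M g -> tau (k *: f + g) = k * tau f + tau g.
Proof. by case: htau => + _ _; exact. Qed.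

Lemma tau0 : tau (0 : bop) = 0.
Proof.
have := tau_linear 1 (memA0 hM) (memA0 hM); rewrite scale1r addr0 mul1r => /eqP.
by rewrite -subr_eq subrr eq_sym => /eqP.
Qed.

Lemma tauD f g : M f -> M g -> tau (f + g) = tau f + tau g.
Proof. by move=> Mf Mg; have := tau_linear 1 Mf Mg; rewrite scale1r mul1r. Qed.

Lemma tauZ k f : M f -> tau (k *: f) = k * tau f.
Proof.
by move=> Mf; have := tau_linear k Mf (memA0 hM); rewrite addr0 tau0 addr0.
Qed.

Lemma tauB f g : M f -> M g -> tau (f - g) = tau f - tau g.
Proof.
move=> Mf Mg; rewrite -scaleN1r tauD//; last exact: memAZ.
by rewrite tauZ// mulN1r.
Qed.

Lemma tau_sum (I : finType) (F : I -> bop) :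
  (forall i, M (F i)) -> tau (\sum_i F i : bop) = \sum_i tau (F i).
Proof.
move=> MF; suff [] : tau (\sum_i F i : bop) = \sum_i tau (F i) /\ M (\sum_i F i : bop) by [].
apply: (big_ind2 (fun (f : bop) t => tau f = t /\ M f)) => //.
  by rewrite tau0; split=> //; exact: memA0.
move=> f t g u [<- Mf] [<- Mg]; split; [exact: tauD | exact: memAD].
Qed.

Lemma tau_ge0 f : M f -> pos f -> 0 <= tau f.
Proof. by case: htau => _ + _; exact. Qed.

Lemma tauC f g : M f -> M g -> tau (f * g) = tau (g * f).
Proof. exact: trtau. Qed.

(** [tau (f * g) = tau (e * g * e)] for the positive square root [e] of [f]. *)
Lemma tau_mul_pos f g : M f -> M g -> pos f -> pos g ->
  0 <= tau (f * g) /\ (tau (f * g) = 0 -> f * g = 0).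
Proof.
move=> Mf Mg f0 g0; have [e [e0 ee ce]] := exists_sqrt hdot f0.
have Me : M e by exact: (memA_bicomm hM Mf).
have se := pos_sa e0.
have Mege : M (e * g * e) by do 2?apply: memAM.
have pege : pos (e * g * e) by exact: pos_conj.
have -> : tau (f * g) = tau (e * g * e).
  by rewrite -ee -mulrA tauC//; exact: memAM.
split; first exact: tau_ge0.
move=> /(fatau Mege pege) E; have ege : e * g * e = 0.
  by apply: bop_eqP => x; have /(congr1 (@^~ x)) := E.
have ge : g * e = 0.
  apply: bop_eqP => x; apply: (pos_ker hdot g0).
  by rewrite -se -!bopME ege bop0E dot0l.
by rewrite -ee -mulrA (sa_mul0 (pos_sa g0) se ge) mulr0.
Qed.

(** [tau (c * p) - tau (c * a)] is the sum of [tau (c * p * (1 - a))] and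
    [tau (- (c * (1 - p)) * a)], both nonnegative. If they vanish, then
    [c * p * (1 - a) = 0], so [a * p = p] and [tau a - tau p = tau (a * (1 - p))];
    if this vanishes too, then [a * (1 - p) = 0]. *)
Lemma spec_proj_max c p a : M c -> spec_proj dot c p ->
    M a -> pos a -> pos (1 - a) ->
  [/\ tau (c * a) <= tau (c * p),
      tau (c * a) = tau (c * p) -> tau p <= tau a &
      tau (c * a) = tau (c * p) -> tau a = tau p -> a = p].
Proof.
move=> Mc [pp bp cp cp' pker] Ma a0 a1.
have Mp : M p := memA_bicomm hM Mc bp.
have M1 := memA1 hM; have [_ sp] := pp; have sa_a := pos_sa a0.
have Mcp : M (c * p) by exact: memAM.
have Mcp' : M (- (c * (1 - p))).
  by rewrite -scaleN1r; apply: memAZ => //; apply: memAM => //; exact: memAB.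
have M1a : M (1 - a) by exact: memAB.
have [le1 eq1] := tau_mul_pos Mcp M1a cp a1.
have [le2 eq2] := tau_mul_pos Mcp' Ma cp' a0.
have E : tau (c * p) - tau (c * a) = tau (c * p * (1 - a)) + tau (- (c * (1 - p)) * a).
  rewrite -tauB//; last exact: memAM.
  rewrite -tauD; [|exact: memAM|exact: memAM].
  congr (tau (bop_fun _)).
  by rewrite mulrBr mulr1 mulrBr mulr1 opprB mulrBl addrA subrK.
have le3 : tau (c * a) <= tau (c * p) by rewrite -subr_ge0 E addr_ge0.
have pa : tau (c * a) = tau (c * p) -> a * p = p.
  move=> eq; have /eqP := E; rewrite eq subrr eq_sym paddr_eq0// => /andP[/eqP /eq1 cpa _].
  have pa0 : p * (1 - a) = 0.
    apply: bop_eqP => x; rewrite bopME; apply: pker.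
    by have /(congr1 (fun f : bop => f x)) := cpa; rewrite !bopME bop0E.
  have /eqP := sa_mul0 sp (pos_sa a1) pa0.
  by rewrite mulrBl mul1r subr_eq0 => /eqP.
have M1p : M (1 - p) by exact: memAB.
have p1p : pos (1 - p) by apply/proj_pos/proj_compl.
have [le4 eq4] := tau_mul_pos Ma M1p a0 p1p.
have ap : tau (c * a) = tau (c * p) -> tau a - tau p = tau (a * (1 - p)).
  move=> /pa ap; rewrite mulrBr mulr1 ap tauB//.
split=> // [/ap E'|eq E']; first by rewrite -subr_ge0 E'.
have /eqP := ap eq; rewrite E' subrr eq_sym => /eqP/eq4/eqP.
by rewrite mulrBr mulr1 (pa eq) subr_eq0 => /eqP.
Qed.

Section SpectralScale.
Variables (n : nat) (b : 'I_n -> bop).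
Hypotheses (bM : forall i, M (b i)) (bsa : forall i, sa (b i)).
Local Notation Psi := (spectral_map tau (fun i => bop_fun (b i))).
Local Notation B := (spectral_scale dot M tau (fun i => bop_fun (b i))).

Definition pencil (t : 'I_n -> R) : bop := \sum_i toC (t i) *: b i.

Lemma pencil_sa t : sa (pencil t).
Proof.
rewrite /pencil; elim/big_ind: _ => [|f g|i _]; [exact: sa0 | exact: saD |].
by apply: saZ => //; exact: toC_real.
Qed.

Lemma pencil_mem t : M (pencil t).
Proof. by apply: memA_sum => // i; exact: memAZ. Qed.

Lemma pencil_shift_mem t s : M (pencil t - toC s *: (1 : bop)).
Proof.
by apply: memAB => //; [exact: pencil_mem | apply: memAZ => //; exact: memA1].
Qed.

(** The linear functional on the space of the spectral scale whose value at the
    image of [a] is the trace of [(pencil t - s) * a]. *)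
Definition scale_form (t : 'I_n -> R) (s : R) (v : 'rV[R]_(1 + n)) : R :=
  \sum_i t i * v 0 (rshift 1 i) - s * v 0 (lshift n 0).

Lemma scale_form_conv t s k v w :
  scale_form t s (k *: v + (1 - k) *: w) =
  k * scale_form t s v + (1 - k) * scale_form t s w.
Proof.
rewrite /scale_form !mxE !mulrBr !mulr_sumr.
rewrite (eq_bigr (fun i => k * (t i * v 0 (rshift 1 i)) +
  (1 - k) * (t i * w 0 (rshift 1 i)))); last by move=> i _; rewrite !mxE; ring.
by rewrite big_split /=; ring.
Qed.

Lemma spectral_map0 a : Psi a 0 (lshift n 0) = complex.Re (tau a).
Proof. by rewrite row_mxEl mxE. Qed.

Lemma spectral_mapS a i :
  Psi a 0 (rshift 1 i) = complex.Re (tau (b i * a)).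
Proof. by rewrite row_mxEr mxE. Qed.

Lemma scale_formE t s a : M a ->
  scale_form t s (Psi a) =
  complex.Re (tau ((pencil t - toC s *: (1 : bop)) * a)).
Proof.
move=> Ma; rewrite mulrBl mulr_suml tauB; last 2 first.
- by apply: memA_sum => // i; apply: memAM => //; exact: memAZ.
- by apply: memAM => //; apply: memAZ => //; exact: memA1.
rewrite tau_sum; last by move=> i; apply: memAM => //; exact: memAZ.
rewrite /scale_form spectral_map0 -bop_scaleAl mul1r tauZ//.
rewrite raddfB raddf_sum; congr (_ - _).
  apply: eq_bigr => i _; rewrite spectral_mapS -bop_scaleAl tauZ; last exact: memAM.
  by case: (tau _) => u v /=; rewrite mul0r subr0.
by case: (tau _) => u v /=; rewrite mul0r subr0.
Qed.

Lemma unit_ballP (a : H -> H) : positive_unit_ball dot M a ->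
  exists f, [/\ bop_fun f = a, M f, pos f & pos (1 - f)].
Proof.
move=> [Ma a0 a1]; have [f fa Mf] := bicommutant_lift hM Ma.
by exists f; rewrite -fa in a0 a1; split.
Qed.

Lemma Re_le (u v : C) : u <= v -> complex.Re u <= complex.Re v.
Proof. by rewrite lecE => /andP[]. Qed.

Lemma Re_inj (u v : C) : u <= v -> complex.Re u = complex.Re v -> u = v.
Proof. by case: u v => [x y] [x' y']; rewrite lecE /= => /andP[/eqP-> _] ->. Qed.

(** If the image of [p] is a convex combination of two points, both maximize the
    linear functional attached to the pencil; then both have the least first
    coordinate among the maximizers. Each of these conditions is an equality case
    of [spec_proj_max], and together they leave only [p]. *)
Lemma spec_proj_extreme t s p : spec_proj dot (pencil t - toC s *: (1 : bop)) p ->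
  extreme_points B (Psi p) /\
  forall a, M a -> pos a -> pos (1 - a) -> Psi a = Psi p -> a = p.
Proof.
set c := pencil t - _ => cp; have Mc : M c := pencil_shift_mem t s.
have [pp bp _ _ _] := cp; have Mp : M p := memA_bicomm hM Mc bp.
have p0 := proj_pos pp; have p1 := proj_pos (proj_compl pp).
have max a : M a -> pos a -> pos (1 - a) ->
  [/\ scale_form t s (Psi a) <= scale_form t s (Psi p),
      scale_form t s (Psi a) = scale_form t s (Psi p) ->
        Psi p 0 (lshift n 0) <= Psi a 0 (lshift n 0) &
      scale_form t s (Psi a) = scale_form t s (Psi p) ->
        Psi a 0 (lshift n 0) = Psi p 0 (lshift n 0) -> a = p].
  move=> Ma a0 a1; have [le1 le2 eq3] := spec_proj_max Mc cp Ma a0 a1.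
  rewrite !spectral_map0 !scale_formE// -/c; split.
  - exact: Re_le.
  - by move=> /(Re_inj le1)/le2/Re_le.
  - move=> /(Re_inj le1) eq eqa; apply: eq3 => //.
    by apply/esym/Re_inj => //; exact: le2.
have pB : B (Psi p) by exists p.
split; last first.
  by move=> a Ma a0 a1 eq; have [_ _] := max a Ma a0 a1; apply; rewrite eq.
split=> // _ _ k [_ /unit_ballP[y [<- My y0 y1]] <-] [_ /unit_ballP[z [<- Mz z0 z1]] <-].
move=> /andP[k0 k1] E; congr (Psi (bop_fun _)).
have [fy ty ey] := max y My y0 y1; have [fz tz ez] := max z Mz z0 z1.
have Ef := scale_form_conv t s k (Psi y) (Psi z); rewrite -E in Ef.
have fyp : scale_form t s (Psi y) = scale_form t s (Psi p) by nra.
have fzp : scale_form t s (Psi z) = scale_form t s (Psi p) by nra.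
have /= Et := congr1 (fun v : 'rV[R]_(1 + n) => v 0 (lshift n 0)) E.
have {}Et : Psi p 0 (lshift n 0) =
    k * Psi y 0 (lshift n 0) + (1 - k) * Psi z 0 (lshift n 0).
  by rewrite {1}E !mxE.
have {}ty := ty fyp; have {}tz := tz fzp.
rewrite ey//; last by nra.
by rewrite ez//; nra.
Qed.

End SpectralScale.
End Trace.
End VonNeumann.

(** * A joint resolution makes the spectral scale a zonotope *)

Section Zonotopes.
Variables (R : realType) (V : lmodType R) (I : finType) (v : I -> V) (w : I -> R).

Definition zonotope : set V :=
  [set x | exists2 m : I -> R, forall i, 0 <= m i <= w i & x = \sum_i m i *: v i].

(** When [0 < m i < w i], moving [m i] to either end of its interval writes [x] as
    an interior point of a segment in the direction of [v i], so that [v i = 0] if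
    [x] is extreme. Thus [x] is the sum of the [w i *: v i] with [m i = w i]. *)
Lemma finite_extreme_zonotope : finite_set (extreme_points zonotope).
Proof.
have fin : finite_set [set: {set I}] by exact: finite_finset.
apply: (sub_finite_set _ (finite_image (fun S : {set I} => \sum_(i in S) w i *: v i) fin)).
move=> x [[m mw xE] xext]; exists [set i | m i == w i]%SET => //.
rewrite xE big_mkcond /=; apply: eq_bigr => i _; rewrite inE.
have [->//|miw] := eqVneq (m i) (w i).
have [mi0|mi0] := eqVneq (m i) 0; first by rewrite mi0 scale0r.
have /andP[m0 m1] := mw i.
have w0 : 0 < w i by rewrite (lt_le_trans _ m1)// lt_def mi0.
pose m' r k := if k == i then r else m k.
have sumE r : \sum_k m' r k *: v k = r *: v i + \sum_(k | k != i) m k *: v k.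
  rewrite (bigD1 i)//= /m' eqxx; congr (_ + _).
  by apply: eq_bigr => k /negPf->.
have mem r : 0 <= r <= w i -> zonotope (\sum_k m' r k *: v k).
  by move=> rw; exists (m' r) => // k; rewrite /m'; case: eqP => // ->.
have y0 : (0 : R) <= 0 <= w i by apply/andP; split=> //; exact: ltW.
have yw : 0 <= w i <= w i by apply/andP; split=> //; exact: ltW.
pose S := \sum_(k | k != i) m k *: v k.
have := xext _ _ (1 - m i / w i) (mem 0 y0) (mem (w i) yw).
rewrite !sumE -/S => eq; suff vi0 : v i = 0 by rewrite vi0 scaler0.
have : 0 *: v i + S = w i *: v i + S.
  apply: eq.
    rewrite subr_gt0 ltr_pdivrMr// mul1r lt_neqAle miw m1 /=.
    by rewrite ltrBlDr ltrDl divr_gt0// lt_def mi0.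
  rewrite scale0r add0r xE (bigD1 i)//= -/S (_ : 1 - (1 - m i / w i) = m i / w i); last by rewrite opprB addrC subrK.
  by rewrite scalerDr scalerBl scale1r addrCA subrK scalerA divfK ?gt_eqF.
by move/addIr/eqP; rewrite scale0r eq_sym scaler_eq0 gt_eqF//= => /eqP.
Qed.

End Zonotopes.

Section ScaleOfResolution.
Variables (R : realType) (H : completeNormedModType R[i]).
Variable dot : {dot H for @Num.conj R[i]}.
Hypothesis hdot : hilbert_dot dot.
Local Notation C := R[i].
Local Notation toC := (real_complex R).
Local Notation bop := (bop H).
Local Notation sa f := (self_adjoint dot (bop_fun f)).
Local Notation pos f := (positive_operator dot (bop_fun f)).
Variables (M : set (H -> H)) (tau : (H -> H) -> C).
Hypothesis hM : bicommutant_closed M.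
Hypotheses (htau : state dot M tau) (trtau : tracial M tau)
  (fatau : faithful dot M tau).
Variables (n : nat) (b : 'I_n -> bop).
Local Notation Psi := (spectral_map tau (fun i => bop_fun (b i))).
Local Notation B := (spectral_scale dot M tau (fun i => bop_fun (b i))).
Variables (I : finType) (q : I -> bop) (l : 'I_n -> I -> R).
Hypotheses (qM : forall i, M (q i)) (rq : resolution dot q).
Hypothesis bq : forall j i, b j * q i = toC (l j i) *: q i.

Definition joint_eigenvalue i : 'rV[R]_(1 + n) :=
  row_mx (\row_(_ < 1) 1) (\row_j l j i).

Definition weight i : R := complex.Re (tau (q i)).

Lemma Re_toCM r (z : C) : complex.Re (toC r * z) = r * complex.Re z.
Proof. by case: z => x y /=; rewrite mul0r subr0. Qed.

Lemma spectral_map_resolution (a : bop) : M a ->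
  Psi a = \sum_i complex.Re (tau (q i * a)) *: joint_eigenvalue i.
Proof.
move=> Ma; have [_ _ q1] := rq; have Mqa i : M (q i * a) by exact: memAM.
apply/rowP => j; rewrite summxE; case: (split_ordP j) => k ->.
  rewrite (_ : k = 0) ?spectral_map0; last by apply/val_inj; case: k => -[].
  have {1}-> : a = \sum_i q i * a by rewrite -mulr_suml q1 mul1r.
  rewrite (tau_sum hM htau)// raddf_sum; apply: eq_bigr => i _.
  by rewrite mxE row_mxEl mxE mulr1.
rewrite spectral_mapS (resolution_expand (l := fun i => toC (l k i)) rq (bq k)).
have -> : (\sum_i toC (l k i) *: q i) * a = \sum_i toC (l k i) *: (q i * a).
  by rewrite mulr_suml; apply: eq_bigr => i _; rewrite bop_scaleAl.
rewrite (tau_sum hM htau); last by move=> i; exact: memAZ.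
rewrite raddf_sum; apply: eq_bigr => i _.
by rewrite mxE row_mxEr mxE (tauZ hM htau)// [RHS]mulrC -Re_toCM.
Qed.

(** The numbers [tau (q i * a)] fill the box of the weights, as shown by the
    operators [a] that are scalar on the range of each [q i]. *)
Lemma spectral_scale_zonotope : B = zonotope joint_eigenvalue weight.
Proof.
have [qp qo q1] := rq; have q0 i : pos (q i) := proj_pos (qp i).
have M1 := memA1 hM.
apply/seteqP; split=> [_ [_ /(unit_ballP hM)[a [<- Ma a0 a1]] <-]|_ [m mw ->]].
  exists (fun i => complex.Re (tau (q i * a))); last exact: spectral_map_resolution.
  move=> i; have M1a : M (1 - a) by exact: memAB.
  have [le0 _] := tau_mul_pos hdot hM htau trtau fatau (qM i) Ma (q0 i) a0.
  have [le1 _] := tau_mul_pos hdot hM htau trtau fatau (qM i) M1a (q0 i) a1.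
  rewrite (Re_le le0) /=; apply: Re_le; rewrite -subr_ge0.
  by move: le1; rewrite mulrBr mulr1 (tauB hM htau)//; exact: memAM.
have w0 i : 0 <= weight i by have /andP[m0] := mw i; apply: le_trans.
pose a : bop := \sum_i toC (m i / weight i) *: q i.
have Ma : M a by apply: memA_sum => // i; exact: memAZ.
have pos_sum (F : I -> bop) : (forall i, pos (F i)) -> pos (\sum_i F i).
  move=> F0; elim/big_ind: _ => [x|f g|//]; last exact: posD.
  by rewrite bop0E dot0l.
have r01 i : 0 <= m i / weight i <= 1.
  have /andP[m0 m1] := mw i; rewrite divr_ge0//=.
  have [->|wi] := eqVneq (weight i) 0; first by rewrite invr0 mulr0.
  by rewrite ler_pdivrMr ?mul1r// lt_def wi w0.
exists a.
  split=> //.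
    apply: pos_sum => i; apply: posZ => //; rewrite (@lecR R 0).
    by case/andP: (r01 i).
  change (pos (1 - a)); rewrite -q1 -sumrB; apply: pos_sum => i.
  rewrite -[X in X - _]scale1r -scalerBl; apply: posZ => //.
  by rewrite subr_ge0 (@lecR R _ 1); case/andP: (r01 i).
rewrite spectral_map_resolution//; apply: eq_bigr => i _; congr (_ *: _).
have -> : q i * a = toC (m i / weight i) *: q i.
  rewrite mulr_sumr (bigD1 i)//= big1 => [|j ji].
    by rewrite addr0 -bop_scaleAr; have [-> _] := qp i.
  by rewrite -bop_scaleAr qo ?scaler0// eq_sym.
rewrite (tauZ hM htau)// Re_toCM -/(weight i).
have [wi|wi] := eqVneq (weight i) 0; last by rewrite divfK.
by rewrite wi mulr0; apply/esym/le_anti; have := mw i; rewrite wi andbC.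
Qed.

Lemma finite_extreme_of_resolution : finite_set (extreme_points B).
Proof. by rewrite spectral_scale_zonotope; exact: finite_extreme_zonotope. Qed.

End ScaleOfResolution.

(** * The generated von Neumann algebra and resolutions *)

Section SpanOfResolution.
Variables (R : realType) (H : completeNormedModType R[i]).
Variable dot : {dot H for @Num.conj R[i]}.
Hypothesis hdot : hilbert_dot dot.
Local Notation C := R[i].
Local Notation bop := (bop H).
Variables (I : finType) (q : I -> bop).
Hypothesis rq : resolution dot q.

Definition resolution_span : set (H -> H) :=
  [set f | exists k : I -> C, f = bop_fun (\sum_i k i *: q i)].

Lemma resolution_span_comm g k : (forall i, GRing.comm g (q i)) ->
  GRing.comm g (\sum_i k i *: q i).
Proof. by move=> gq; apply: comm_sum => i; exact: comm_scale. Qed.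

Lemma resolution_comm i j : GRing.comm (q i) (q j).
Proof.
have [_ qo _] := rq; have [->|ij] := eqVneq i j; first exact: commr_refl.
by rewrite /GRing.comm !qo// eq_sym.
Qed.

Fact rank_one_bop (x y : H) : (fun z => dot z x *: y) \in @is_bop R H.
Proof.
apply/is_bopP; have lf : linear (fun z => dot z x *: y).
  by move=> k u w; rewrite dotDl dotZl scalerDl scalerA.
split=> //; pose F := GRing.isLinear.Build C H H *:%R _ lf.
pose Fl : {linear H -> H} := HB.pack (fun z => dot z x *: y) F.
apply: (@bounded_linear_continuous _ _ _ Fl); apply/linear_boundedP.
exists (`|x| * `|y|); split; first by rewrite realM// normr_real.
move=> r rxy z; rewrite normrZ; apply: (@le_trans _ _ (`|z| * `|x| * `|y|)).
  by rewrite ler_wpM2r// (dot_le_norm hdot).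
by rewrite -mulrA mulrC ler_wpM2r// ltW.
Qed.

Definition rank_one x y : bop := Bop (rank_one_bop x y).

(** An operator of the bicommutant commutes with the rank-one operators that
    live on the range of a single [q i], hence acts there as a scalar. *)
Lemma resolution_span_bicommutant (f : bop) :
    (forall g : bop, (forall i, GRing.comm g (q i)) -> GRing.comm g f) ->
  exists k : I -> C, f = \sum_i k i *: q i.
Proof.
move=> fc; have [qp qo _] := rq.
suff /choice[k fk] : forall i, exists k : C, f * q i = k *: q i.
  by exists k; exact: (resolution_expand rq fk).
move=> i; have [qqi sqi] := qp i.
have [[x qx0]|q0] := pselect (exists x, q i x != 0); last first.
  exists 0; rewrite scale0r (_ : q i = 0) ?mulr0//; apply: bop_eqP => x.
  by apply/eqP; apply: contrapT => qx; apply: q0; exists x; apply/negP.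
pose u := q i x; have qu : q i u = u by rewrite /u -bopME qqi.
have du : dot u u != 0 by rewrite dnorm_eq0.
exists (dot (f u) u / dot u u); apply: bop_eqP => y; rewrite bopME bopZE.
have ranki j : GRing.comm (rank_one u (q i y)) (q j).
  apply: bop_eqP => z; rewrite !bopME /rank_one /= bop_Z.
  have [_ sqj] := qp j; rewrite sqj.
  have [->|ji] := eqVneq j i; first by rewrite qu -[q i (q i y)]bopME qqi.
  have qj0 z' : q j (q i z') = 0 by rewrite -bopME qo.
  by rewrite !qj0 dot0r scale0r scaler0.
have /(congr1 (fun g : bop => g u)) := fc _ ranki.
rewrite !bopME /rank_one /= bop_Z => /(congr1 (GRing.scale (dot u u)^-1)).
by rewrite !scalerA mulVf// scale1r mulrC => ->.
Qed.

(** The span of a resolution is a von Neumann algebra, so a generated algebra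
    whose generators lie in it cannot be larger. *)
Lemma von_neumann_resolution_span : von_neumann_algebra dot resolution_span.
Proof.
have [qp _ _] := rq; split.
  move=> _ [k ->]; exists (bop_fun (\sum_i (k i)^* *: q i)); first by eexists.
  elim/big_ind2: _ => [x y|f f' g g' ff gg x y|i _ x y].
  - by rewrite !bop0E dot0l dot0r.
  - by rewrite !bopDE dotDl dotDr ff gg.
  - by rewrite !bopZE dotZl dotZr conjCK; have [_ ->] := qp i.
apply/seteqP; split=> [f [bf fc]|_ [k ->]].
  have [|k fk] := @resolution_span_bicommutant (Bop (introT (is_bopP f) bf)).
    move=> g gq; suff /fc E : commutant resolution_span g.
      by apply: bop_eqP => x; exact: (congr1 (fun h : H -> H => h x) (esym E)).
    split; first exact/is_bopP/bopP.
    move=> _ [k ->]; have := resolution_span_comm k gq.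
    exact: (congr1 (@bop_fun R H)).
  by exists k; rewrite -fk.
split; first exact/is_bopP/bopP.
by move=> g [bg gq]; apply/esym/gq; exists k.
Qed.

End SpanOfResolution.

Section Generated.
Variables (R : realType) (H : completeNormedModType R[i]).
Variable dot : {dot H for @Num.conj R[i]}.
Hypothesis hdot : hilbert_dot dot.
Local Notation C := R[i].
Local Notation toC := (real_complex R).
Local Notation bop := (bop H).
Local Notation sa f := (self_adjoint dot (bop_fun f)).
Local Notation pos f := (positive_operator dot (bop_fun f)).
Variables (M : set (H -> H)) (n : nat) (b : 'I_n -> bop).
Hypothesis vnM : von_neumann_algebra dot M.
Hypotheses (bM : forall i, M (b i)) (bsa : forall i, sa (b i)).
Local Notation N := (generated_von_neumann dot M (range (fun i => bop_fun (b i)))).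

Lemma generated_mem_bicommutant (f : bop) :
    (forall g, (forall i, GRing.comm g (b i)) -> GRing.comm g f) -> N f.
Proof.
move=> fc A [[vnA AM] bA]; have hA := von_neumann_bicommutant vnA.
apply hA.2 => g gA; apply: fc => i; apply: gA; apply: bA.
by left; exists i.
Qed.

Lemma generated_bicommutant_closed : bicommutant_closed N.
Proof.
have hM := von_neumann_bicommutant vnM.
split=> [f Nf|f fc].
  apply hM.1; apply: Nf; split; first by split.
  by move=> _ [[i _ <-]|->]; [exact: bM | exact: (memA1 hM)].
move=> A [[vnA AM] bA]; have hA := von_neumann_bicommutant vnA.
apply hA.2 => g gA; apply: fc => h Nh; apply: gA; exact: Nh.
Qed.

Lemma generated_b i : N (b i).
Proof. by apply: generated_mem_bicommutant => g; exact. Qed.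

Lemma generated_sub : N `<=` M.
Proof.
have hM := von_neumann_bicommutant vnM.
move=> f; apply; split; first by split.
by move=> _ [[i _ <-]|->]; [exact: bM | exact: (memA1 hM)].
Qed.

Section FromResolution.
Variables (I : finType) (q : I -> bop) (l : 'I_n -> I -> R).
Hypotheses (rq : resolution dot q) (qN : forall i, N (q i)).
Hypothesis bq : forall j i, b j * q i = toC (l j i) *: q i.

Lemma generated_sub_span : N `<=` resolution_span q.
Proof.
have hM := von_neumann_bicommutant vnM; have [_ _ q1] := rq.
move=> f; apply; split; first split.
- exact: von_neumann_resolution_span.
- move=> _ [k ->]; apply: memA_sum => // i; apply: memAZ => //.
  exact: generated_sub.
move=> _ [[j _ <-]|->].
  exists (fun i => toC (l j i)); congr bop_fun.
  exact: (resolution_expand rq (bq j)).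
exists (fun=> 1); rewrite (eq_bigr q) ?q1// => i _; exact: scale1r.
Qed.

Lemma generated_abelian_of_resolution : abelian_algebra N.
Proof.
move=> f g /generated_sub_span[k ->] /generated_sub_span[k' ->].
have : GRing.comm (\sum_i k i *: q i) (\sum_i k' i *: q i).
  apply: resolution_span_comm => i; apply/commr_sym/resolution_span_comm => j.
  exact: (resolution_comm rq).
exact: (congr1 (@bop_fun R H)).
Qed.

Lemma generated_finite_of_resolution : finite_dimensional N.
Proof.
exists #|I|, (fun j => bop_fun (q (enum_val j))); split=> [j|]; first exact: qN.
move=> f /generated_sub_span[k ->]; exists (fun j => k (enum_val j)).
rewrite (reindex (@enum_val I I)) /=; last exact/onW_bij/enum_val_bij.
by elim/big_ind2: _ => // f1 f2 g1 g2 <- <-.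
Qed.

End FromResolution.

Section ToResolution.
Hypotheses (abN : abelian_algebra N) (fdN : finite_dimensional N).

Let hN := generated_bicommutant_closed.

Lemma generated_comm (f g : bop) : N f -> N g -> GRing.comm f g.
Proof.
by move=> Nf Ng; apply: bop_eqP => x; have /(congr1 (@^~ x)) := abN Nf Ng.
Qed.

Definition orthogonal_family (I : finType) (q : I -> bop) :=
  [/\ forall i, N (q i), forall i, is_proj dot (q i), forall i, q i <> 0 &
      forall i j, i != j -> q i * q j = 0].

(** Nonzero pairwise orthogonal projections are linearly independent: multiply a
    linear relation by one of them. *)
Lemma orthogonal_family_bounded : exists k, forall (I : finType) (q : I -> bop),
  orthogonal_family q -> (#|I| <= k)%N.
Proof.
have [k [e [_ eN]]] := fdN; exists k => I q [qN qp q0 qo]; rewrite leqNgt; apply/negP => kI.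
have /choice[c ec] : forall j : 'I_#|I|, exists c : 'I_k -> C,
  bop_fun (q (enum_val j)) = \sum_(i < k) c i *: e i by move=> j; apply: eN.
pose A := \matrix_(j < #|I|, i < k) c j i.
have : kermx A != 0.
  by rewrite -mxrank_eq0 mxrank_ker subn_eq0 -ltnNge (leq_ltn_trans (rank_leq_col _)).
move=> /rowV0Pn[u /sub_kermxP uA u0].
have sum0 : \sum_(j < #|I|) u 0 j *: q (enum_val j) = 0.
  apply: bop_eqP => x.
  have -> : (\sum_(j < #|I|) u 0 j *: q (enum_val j)) x =
     \sum_(j < #|I|) u 0 j *: q (enum_val j) x.
    by elim/big_ind2: _ => // f y g z; rewrite bopDE => -> ->.
  under eq_bigr => j _ do rewrite ec fct_sumE scaler_sumr.
  rewrite exchange_big /= big1 // => i _.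
  have /rowP/(_ i) := uA; rewrite !mxE => uAi.
  rewrite -[RHS](scale0r (e i x)) -uAi scaler_suml; apply: eq_bigr => j _.
  by rewrite !mxE scalerA.
have /rV0Pn[j uj] := u0.
have := congr1 (fun f => f * q (enum_val j)) sum0.
rewrite mul0r mulr_suml (bigD1 j)//= big1 => [|i ij].
  rewrite addr0 -bop_scaleAl; have [-> _] := qp (enum_val j).
  by move/eqP; rewrite scaler_eq0 (negPf uj)/= => /eqP/q0.
by rewrite -bop_scaleAl qo ?scaler0// (inj_eq enum_val_inj).
Qed.

(** A family of maximal size: a projection deciding neither way on some [q i]
    would split it, and a nonzero complement of the sum could be added. *)
Lemma exists_minimal_resolution : exists (I : finType) (q : I -> bop),
  [/\ resolution dot q, forall i, N (q i) &
      forall p : bop, N p -> is_proj dot p -> forall i, decides p (q i)].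
Proof.
have [k kb] := orthogonal_family_bounded.
pose P m := `[< exists (I : finType) (q : I -> bop), #|I| = m /\ orthogonal_family q >].
have exP : exists m, P m.
  exists 0; apply/asboolP; exists void, (fun=> 0); rewrite card_void.
  by split=> //; split; case.
have ubP m : P m -> (m <= k)%N.
  by move=> /asboolP[I [q [<- /kb]]].
have [m /asboolP[I [q [<- [qN qp q0 qo]]]] mmax] := ex_maxnP exP ubP.
have nomore (q' : option I -> bop) : ~ orthogonal_family q'.
  move=> oq'; have : P #|{: option I}| by apply/asboolP; exists (option I), q'.
  by move=> /mmax; rewrite card_option ltnn.
exists I, q; split=> //; last first.
  move=> p Np pp i; have [//|pq0] := pselect (decides p (q i)).
  exfalso; have {pq0}[pq1 pq0] : p * q i <> q i /\ p * q i <> 0.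
    by split=> E; apply: pq0; [left | right].
  have cpq j : GRing.comm p (q j) by apply: generated_comm.
  have [ppp _] := pp; have [qqi _] := qp i.
  have Np' : N (1 - p) by apply: (memAB hN) => //; exact: (memA1 hN).
  have cpq' j : GRing.comm (1 - p) (q j) by apply: generated_comm.
  pose q' o := if o is Some j then if j == i then p * q i else q j else (1 - p) * q i.
  apply: (nomore q'); split=> [[j|]|[j|]|[j|]|[j|] [j'|]]; rewrite /q'.
  - by case: eqP => // _; exact: (memAM hN).
  - exact: (memAM hN).
  - by case: eqP => // _; exact: proj_mul.
  - by apply: proj_mul => //; exact: proj_compl.
  - by case: eqP => // _; exact: q0.
  - by rewrite mulrBl mul1r => /eqP; rewrite subr_eq0 eq_sym => /eqP.
  - rewrite (inj_eq Some_inj) => jj'.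
    have [ji|ji] := eqVneq j i; have [j'i|j'i] := eqVneq j' i.
    + by move: jj'; rewrite ji j'i eqxx.
    + by rewrite -mulrA qo ?mulr0// eq_sym.
    + by rewrite cpq mulrA qo ?mul0r.
    + exact: qo.
  - move=> _; case: eqVneq => [_|ji].
      by rewrite -mulrA (mulrA (q i)) -cpq' -mulrA mulrA mulrBr mulr1 ppp subrr mul0r.
    by rewrite cpq' mulrA qo ?mul0r.
  - move=> _; case: eqVneq => [_|ji].
      by rewrite -mulrA (mulrA (q i)) -cpq -mulrA mulrA mulrBl mul1r ppp subrr mul0r.
    by rewrite -mulrA qo ?mulr0// eq_sym.
  - by rewrite eqxx.
split=> //; apply/eqP; rewrite eq_sym -subr_eq0; apply/eqP; apply: contrapT => r0.
pose r := 1 - \sum_i q i; rewrite -/r in r0.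
have qr i : q i * r = 0.
  rewrite mulrBr mulr1 mulr_sumr (bigD1 i)//= big1 => [|j ji].
    by have [-> _] := qp i; rewrite addr0 subrr.
  by rewrite qo// eq_sym.
have Nr : N r by apply: (memAB hN) => //; [exact: (memA1 hN) | exact: (memA_sum hN)].
have rq i : r * q i = 0 by rewrite (generated_comm Nr (qN i)).
apply: (nomore (fun o => if o is Some i then q i else r)).
split=> [[j|]|[j|]|[j|]|[j|] [j'|]] //; first last.
- by rewrite (inj_eq Some_inj); exact: qo.
split; first by rewrite {1}/r mulrBl mul1r mulr_suml big1 ?subr0// => i _.
apply: saB; first exact: sa1.
by elim/big_ind: _ => [|f g|i _]; [exact: sa0 | exact: saD | have [] := qp i].
Qed.

(** The spectral projections of the generators lie in [N], hence are decided by a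
    minimal resolution. *)
Lemma exists_generated_resolution : exists (I : finType) (q : I -> bop) (l : 'I_n -> I -> R),
  [/\ resolution dot q, forall i, N (q i) & forall j i, b j * q i = toC (l j i) *: q i].
Proof.
have [I [q [rq qN qd]]] := exists_minimal_resolution; have [qp _ _] := rq.
have : forall ji : 'I_n * I, exists l : R, b ji.1 * q ji.2 = toC l *: q ji.2.
  move=> [j i] /=; apply: (scalar_of_decided hdot) => //.
    by apply: generated_comm => //; exact: generated_b.
  move=> s; have [p sp] := exists_spec_proj hdot (sa_shift s (bsa j)).
  exists p => //; have [pp cp _ _ _] := sp; apply: qd => //.
  apply: (memA_bicomm hN (generated_b j)).
  by apply: (@spec_proj_of_bicomm _ _ dot); exists s.
by move=> /choice[l bl]; exists I, q, (fun j i => l (j, i)); split=> // j i; exact: (bl (j, i)).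
Qed.

End ToResolution.
End Generated.

(** * From finitely many extreme points to a resolution *)

Section FiniteExtreme.
Variables (R : realType) (H : completeNormedModType R[i]).
Variable dot : {dot H for @Num.conj R[i]}.
Hypothesis hdot : hilbert_dot dot.
Local Notation C := R[i].
Local Notation toC := (real_complex R).
Local Notation bop := (bop H).
Local Notation sa f := (self_adjoint dot (bop_fun f)).
Variables (M : set (H -> H)) (tau : (H -> H) -> C).
Hypothesis hM : bicommutant_closed M.
Hypotheses (htau : state dot M tau) (trtau : tracial M tau)
  (fatau : faithful dot M tau).
Variables (n : nat) (b : 'I_n -> bop).
Hypotheses (bM : forall i, M (b i)) (bsa : forall i, sa (b i)).
Local Notation Psi := (spectral_map tau (fun i => bop_fun (b i))).
Local Notation B := (spectral_scale dot M tau (fun i => bop_fun (b i))).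

Definition pencil_proj : set bop :=
  [set p | exists t, spec_proj_of dot (pencil b t) p].

(** The spectral map is injective on these projections, with extreme values. *)
Lemma finite_pencil_proj : finite_set (extreme_points B) -> finite_set pencil_proj.
Proof.
pose D e := [set p : bop | pencil_proj p /\ Psi p = e].
move=> /(finite_image (fun e => xget 0 (D e))); apply: sub_finite_set => p [t [s tp]].
have [ep p_inj] := spec_proj_extreme hdot hM htau trtau fatau bM tp.
exists (Psi p) => //; have : D (Psi p) (xget 0 (D (Psi p))).
  by apply: xgetPex; exists p; split=> //; exists t, s.
move: (xget 0 _) => p' [[t' [s' [pp' cp' _ _ _]]] E]; apply: p_inj => //.
- exact: (memA_bicomm hM (pencil_shift_mem hM bM t' s')).
- exact: proj_pos.
- exact/proj_pos/proj_compl.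
Qed.

Lemma pencil_line i j (e : R) :
  pencil b (fun k => (k == i)%:R + e * (k == j)%:R) = b i + toC e *: b j.
Proof.
rewrite /pencil.
under eq_bigr => k _ do rewrite rmorphD rmorphM /= !rmorph_nat scalerDl.
rewrite big_split /= (bigD1 i)//= eqxx scale1r big1 ?addr0; last first.
  by move=> k /negPf->; rewrite scale0r.
rewrite (bigD1 j)//= eqxx mulr1 big1 ?addr0//.
by move=> k /negPf->; rewrite mulr0 scale0r.
Qed.

(** By the pigeonhole principle, [b i + e b j] and [b i + e' b j] have the same
    spectral projections for some natural numbers [e != e']. Each of the two
    operators commutes with its own spectral projections, so they commute with
    one another, and [b i] and [b j] are linear combinations of them. *)
Lemma finite_pencil_proj_comm : finite_set pencil_proj ->
  forall i j, GRing.comm (b i) (b j).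
Proof.
move=> /finite_seqP[P PE] i j.
pose c (e : nat) := pencil b (fun k => (k == i)%:R + e%:R * (k == j)%:R).
pose S (e : nat) := [set k : 'I_(size P) | `[< spec_proj_of dot (c e) (nth 0 P k) >]]%SET.
have mem e p : spec_proj_of dot (c e) p -> p \in P.
  move=> ep; have : pencil_proj p by exists (fun k => (k == i)%:R + e%:R * (k == j)%:R).
  by rewrite PE.
pose T := {set 'I_(size P)}.
have /injectivePn[e [e' ne Se]] : ~~ injectiveb (fun e : 'I_#|{: T}|.+1 => S e).
  apply/negP => /injectiveP/leq_card; by rewrite card_ord ltnn.
have cc' : GRing.comm (c e') (c e).
  pose L := [seq p <- P | `[< spec_proj_of dot (c e) p >]].
  apply: (@comm_of_spec_proj _ _ dot hdot _ L); first exact: pencil_sa.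
    move=> p; rewrite mem_filter; split=> [/andP[/asboolP]//|ep].
    by rewrite (mem e)// andbT; apply/asboolP.
  move=> p; rewrite mem_filter => /andP[/asboolP ep pP].
  have kP : (index p P < size P)%N by rewrite index_mem.
  have : Ordinal kP \in S e by rewrite inE /= nth_index//; apply/asboolP.
  rewrite Se inE /= nth_index// => /asboolP/spec_proj_of_bicomm; apply.
  exact: commr_refl.
have cE (k : nat) : c k = b i + toC k%:R *: b j by exact: pencil_line.
have r0 : toC ((e : nat)%:R - (e' : nat)%:R) != 0.
  by rewrite fmorph_eq0 subr_eq0 eqr_nat.
have cbj : GRing.comm (c e') (b j).
  have cd : c e - c e' = toC ((e : nat)%:R - (e' : nat)%:R) *: b j.
    by rewrite !cE opprD addrACA subrr add0r -scalerBl -rmorphB.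
  rewrite -[b j]scale1r -(mulVf r0) -scalerA -cd; apply: comm_scale.
  exact: commrB cc' (commr_refl (c e')).
apply/commr_sym; rewrite -(addrK (toC (e' : nat)%:R *: b j) (b i)) -cE.
by apply: commrB; [exact: commr_sym | apply/comm_scale/commr_refl].
Qed.

(** The atoms of the spectral projections of all the [b j], which commute and are
    finite in number. *)
Lemma finite_extreme_resolution : finite_set (extreme_points B) ->
  exists (I : finType) (q : I -> bop) (l : 'I_n -> I -> R),
  [/\ resolution dot q, forall j i, b j * q i = toC (l j i) *: q i &
      forall g i, (forall j, GRing.comm g (b j)) -> GRing.comm g (q i)].
Proof.
move=> /finite_pencil_proj fP; have cb := finite_pencil_proj_comm fP.
have [P PE] := (finite_seqP _).1 fP.
pose L := [seq p <- P | `[< exists j, spec_proj_of dot (b j) p >]].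
have LP p : p \in L <-> exists j, spec_proj_of dot (b j) p.
  rewrite mem_filter; split=> [/andP[/asboolP]//|bp].
  apply/andP; split; first exact/asboolP.
  have : pencil_proj p; last by rewrite PE.
  (* [b j] is the point [e = 0] of a line of pencils. *)
  have [j jp] := bp; exists (fun k => (k == j)%:R + 0 * (k == j)%:R).
  by rewrite pencil_line rmorph0 scale0r addr0.
have [I [q [rq ql qc]]] := simultaneous_resolution hdot bsa cb LP.
have /choice[l bl] : forall ji : 'I_n * I, exists l : R, b ji.1 * q ji.2 = toC l *: q ji.2.
  by move=> [j i]; exact: ql.
exists I, q, (fun j i => l (j, i)); split=> // [j i|g i gb]; first exact: (bl (j, i)).
by apply: qc => p /LP[j /spec_proj_of_bicomm]; apply.
Qed.

End FiniteExtreme.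

Theorem corollary5p6 (R : realType) (H : completeNormedModType R[i])
    (dot : {dot H for @Num.conj R[i]}) (hdot : hilbert_dot dot)
    (M : set (H -> H)) (vnM : von_neumann_algebra dot M)
    (finM : finite_algebra dot M)
    (tau : (H -> H) -> R[i]) (htau : faithful_normal_tracial_state dot M tau)
    (n : nat) (n_gt0 : (0 < n)%N) (b : 'I_n -> H -> H)
    (bM : forall i, M (b i)) (bsa : forall i, self_adjoint dot (b i)) :
  let N := generated_von_neumann dot M (range b) in
  let B := spectral_scale dot M tau b in
  abelian_algebra N /\ finite_dimensional N <-> finite_set (extreme_points B).
Proof.
have hM := von_neumann_bicommutant vnM.
have /choice[c cb] : forall i, exists f : bop H, bop_fun f = b i.
  by move=> i; have [f fb _] := bicommutant_lift hM (bM i); exists f.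
have {cb}bE : b = (fun i => bop_fun (c i)) by apply: funext => i; rewrite cb.
subst b; case: htau => st tr fa _; split=> [[abN fdN]|fin].
  have [I [q [l [rq qN cq]]]] := exists_generated_resolution hdot vnM bM bsa abN fdN.
  apply: (finite_extreme_of_resolution hdot hM st tr fa _ rq cq) => i.
  exact: (generated_sub vnM bM (qN i)).
have [I [q [l [rq cq qc]]]] := finite_extreme_resolution hdot hM st tr fa bM bsa fin.
have qN i : generated_von_neumann dot M (range (fun i => bop_fun (c i))) (q i).
  by apply: generated_mem_bicommutant => g; exact: qc.
split; first exact: (generated_abelian_of_resolution hdot vnM bM rq qN cq).
exact: (generated_finite_of_resolution hdot vnM bM rq qN cq).
Qed.
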